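(* Define $r_0(2)=2$ and $r_0(d)=3$ for all integers $d\ge 3$. Let $d\ge 2$ be an integer and let $r\in\mathbb{N}$ with $r\ge r_0(d)$. Then for all $n$ sufficiently large depending on $d$ and $r$, with probability at least $1-\exp(-n^{1/13})$, the largest component of the random graph $G_n(\mathbb{L}^d,r)$ has order at most $n^{5/6}$.
   Context: Graphs are simple and undirected, and need not be connected. An unlabelled graph is an isomorphism class of graphs; the order of a component is its number of vertices. $\mathbb{L}^d$ is the graph with vertex-set $\mathbb{Z}^d$ and edge-set $\{\{x,x+e_i\}: x\in\mathbb{Z}^d, 1\le i\le d\}$, where $e_i$ is the $i$th standard unit vector. For a graph $G$, a vertex $v$ and $r\in\mathbb{N}$, $\mathrm{Link}_r(v,G)$ denotes the subgraph of $G$ induced by the set of vertices at graph distance at most $r$ from $v$. If $F$ is a vertex-transitive graph and $u\in V(F)$, a graph $G$ is $r$-locally $F$ if for every $v\in V(G)$ there is a graph isomorphism $\phi:\mathrm{Link}_r(u,F)\to\mathrm{Link}_r(v,G)$ with $\phi(u)=v$ (independent of the choice of $u$). $G_n(F,r)$ denotes a graph chosen uniformly at random from the set of all unlabelled $n$-vertex graphs that are $r$-locally $F$; for $F=\mathbb{L}^d$ this set is nonempty for all sufficiently large $n$. *)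

(* Defs.v *)
From HB Require Import structures.
From mathcomp Require Import all_boot all_order all_algebra.
From mathcomp Require Import generic_quotient.
From mathcomp Require Import boolp classical_sets reals.
Set Implicit Arguments.
Unset Strict Implicit.
Unset Printing Implicit Defensive.
Import Order.TTheory GRing.Theory Num.Theory.
Local Open Scope ring_scope.

Record sgraph := SGraph {
  vertex :> Type;
  adj : rel vertex;
  adj_sym : symmetric adj;
  adj_irr : irreflexive adj }.
Arguments adj {s} _ _.

Definition graph_iso (G H : sgraph) (phi : G -> H) : Prop :=
  bijective phi /\ forall x y : G, adj (phi x) (phi y) = adj x y.

Definition isomorphic (G H : sgraph) : Prop :=
  exists phi : G -> H, graph_iso phi.

Section Induced.
Variables (G : sgraph) (A : set G).

Definition induced_adj : rel (set_type A) := fun x y => adj (val x) (val y).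

Fact induced_adj_sym : symmetric induced_adj.
Proof. by move=> x y; rewrite /induced_adj adj_sym. Qed.

Fact induced_adj_irr : irreflexive induced_adj.
Proof. by move=> x; rewrite /induced_adj adj_irr. Qed.

Definition induced := SGraph induced_adj_sym induced_adj_irr.
End Induced.

(* Distance at most r means that some walk with at most r edges joins v to w;
   size p is the number of edges of the walk v :: p. *)
Definition gball (G : sgraph) (r : nat) (v : G) : set G :=
  [set w | exists p : seq G, [/\ path adj v p, last v p = w & (size p <= r)%N]]%classic.

Fact gball_center (G : sgraph) (r : nat) (v : G) : gball r v v.
Proof. by exists [::]. Qed.

Definition link (G : sgraph) (r : nat) (v : G) : sgraph := induced (gball r v).

Definition link_center (G : sgraph) (r : nat) (v : G) : link r v :=
  exist _ v (mem_set (gball_center r v)).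

(* For vertex-transitive F the choice of the root u is immaterial. *)
Definition locally (F : sgraph) (u : F) (r : nat) (G : sgraph) : Prop :=
  forall v : G, exists phi : link r u -> link r v,
    graph_iso phi /\ phi (link_center r u) = link_center r v.

Section Lattice.
Variable d : nat.

Definition unit_vec (i : 'I_d) : 'rV[int]_d := delta_mx 0 i.

Definition lattice_adj : rel 'rV[int]_d :=
  fun x y => [exists i, (y == x + unit_vec i) || (x == y + unit_vec i)].

Fact lattice_adj_sym : symmetric lattice_adj.
Proof. by move=> x y; apply: eq_existsb => i; rewrite orbC. Qed.

Fact lattice_adj_irr : irreflexive lattice_adj.
Proof.
move=> x; apply/existsP => -[i]; rewrite orbb -subr_eq0 opprD addNKr oppr_eq0.
by move/eqP/matrixP/(_ 0 i); rewrite !mxE !eqxx.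
Qed.

Definition lattice := SGraph lattice_adj_sym lattice_adj_irr.
End Lattice.

(* A labelled graph on 'I_n is given by its set of edges. *)
Definition lgraph (n : nat) :=
  {E : {set {set 'I_n}} | [forall e in E, #|e| == 2%N]}.

Section LabelledGraph.
Variables (n : nat) (E : lgraph n).

Definition lgraph_adj : rel 'I_n := fun x y => [set x; y] \in val E.

Fact lgraph_adj_sym : symmetric lgraph_adj.
Proof. by move=> x y; rewrite /lgraph_adj finset.setUC. Qed.

Fact lgraph_adj_irr : irreflexive lgraph_adj.
Proof.
move=> x; apply/negbTE/negP => /(forall_inP (valP E)).
by rewrite finset.setUid cards1.
Qed.

Definition sgraph_of : sgraph := SGraph lgraph_adj_sym lgraph_adj_irr.
End LabelledGraph.

Definition lgraph_iso (n : nat) : rel (lgraph n) :=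
  fun E1 E2 => `[< isomorphic (sgraph_of E1) (sgraph_of E2) >].

Fact lgraph_iso_refl n : reflexive (@lgraph_iso n).
Proof. by move=> E; apply/asboolP; exists id; split => //; exists id. Qed.

Fact lgraph_iso_sym n : symmetric (@lgraph_iso n).
Proof.
suff sub E1 E2 : @lgraph_iso n E1 E2 -> lgraph_iso E2 E1.
  by move=> E1 E2; apply/idP/idP; apply: sub.
move=> /asboolP[f [[g fK gK] fE]]; apply/asboolP; exists g.
by split=> [|x y]; [exists f | rewrite -fE !gK].
Qed.

Fact lgraph_iso_trans n : transitive (@lgraph_iso n).
Proof.
move=> E2 E1 E3 /asboolP[f [fb fE]] /asboolP[g [gb gE]].
apply/asboolP; exists (g \o f).
by split=> [|x y]; [exact: bij_comp | rewrite -fE -gE].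
Qed.

Canonical lgraph_iso_equiv n :=
  EquivRel (@lgraph_iso n) (@lgraph_iso_refl n) (@lgraph_iso_sym n)
    (@lgraph_iso_trans n).

(* Unlabelled graphs are isomorphism classes; isomorphism-invariant notions are
   evaluated at the canonical representative repr g of the class g. *)
Definition ugraph (n : nat) := {eq_quot lgraph_iso_equiv n}%qT.
HB.instance Definition _ n := Quotient.on (ugraph n).
HB.instance Definition _ n := [Finite of ugraph n by <:%/].

Definition ugraph_sgraph (n : nat) (g : ugraph n) : sgraph :=
  sgraph_of (repr g).

Definition components (n : nat) (E : lgraph n) : {set {set 'I_n}} :=
  equivalence_partition (connect (lgraph_adj E)) [set: 'I_n].

Definition max_component_order (n : nat) (g : ugraph n) : nat :=
  \max_(C in components (repr g)) #|C|.

Definition unlabelled_locally (F : sgraph) (u : F) (r n : nat) :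
    {set ugraph n} :=
  [set g : ugraph n | `[< locally u r (ugraph_sgraph g) >]].

Definition uniform_prob (R : realType) (T : finType) (A : {set T})
    (P : pred T) : R :=
  #|[set x in A | P x]|%:R / #|A|%:R.

Definition r0 (d : nat) : nat := if d == 2%N then 2%N else 3%N.

(* Main.v *)
Require Import Defs.
From HB Require Import structures.
From mathcomp Require Import all_boot all_order all_algebra.
From mathcomp Require Import boolp classical_sets reals sequences exp.
From mathcomp Require Import zify lra.
Import Order.TTheory GRing.Theory Num.Theory.
Local Open Scope ring_scope.
Set Implicit Arguments.
Unset Strict Implicit.
Unset Printing Implicit Defensive.

(** Write [U n] for the set of unlabelled [n]-vertex graphs that are [r]-locally
    the lattice. The claim is that few of them have a component of order
    [m > n^(5/6)], and it rests on two estimates.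

    First, there are only polynomially many connected graphs of order [m] in
    [U m]. Such a graph [G] is a quotient of the lattice. Call two neighbours of a
    vertex opposite if they span no 4-cycle with it, and call frame at [v] a
    labelling of the neighbours of [v] by the [2 d] directions under which
    opposite neighbours get opposite directions. A frame can be moved along an
    edge, by pushing the other edges across the 4-cycles that they span with it
    ([transport_frame]). Radius 3, or radius 2 in dimension 2, suffices for the
    moves in two directions to commute ([transportC]), because the cubes at a
    vertex close up. Hence [Z^d] acts on frames, and the orbit of one frame maps
    [Z^d] onto the vertices of [G]. Two points have the same image exactly when
    the frames there differ by a relabelling of the directions, so the kernel of
    this map is given by the lattice of periods, together with one coset of it for
    some of the relabellings. The lattice of periods contains [k Z^d] with [k]
    polynomial in [m], and has [d] generators; reducing everything modulo [k]
    gives a code of [G] that ranges over polynomially many values ([ex_coded],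
    [card_code_le]). So the number of graphs in [U n] with a component of order [m]
    is at most [|U (n - m)|] times a polynomial in [n] ([card_with_component]).

    Second, [|U n|] is much larger than [|U (n - m)|]. The circulant graph on
    [Z/a] with steps [1, s, ..., s^(d-1)], with [s = 2 r + 2], is locally the
    lattice as soon as [a >= s^d] ([circulant_local]), so components of every large
    order are available. To a graph in [U (n - m)] add circulants of total order
    [m], the orders of [t] of them being chosen freely among [q] values. The result
    lies in [U n], and by cancellation ([gsum_cancel]) it determines the original
    graph once the [t] orders are known. These are component orders of the
    result; distinct component orders have sum at most [n], so there are at most
    [D ~ sqrt (2 n)] of them. Hence [|U (n - m)| q^t <= |U n| D^t]
    ([card_local_growth]). With [n ~ b^12] one may take [t = b], [q = b^8] and
    [D ~ 2 b^6], so that [(D / q)^t] is at most [8^-b]; this absorbs the polynomial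
    factors and leaves a proportion below [exp (- (b + 1))], where
    [n^(1/13) <= b + 1] ([card_large_component]). *)

(** * Graphs up to isomorphism *)

Lemma isomorphic_refl (G : sgraph) : isomorphic G G.
Proof. by exists id; split => //; exists id. Qed.

Lemma isomorphic_sym (G H : sgraph) : isomorphic G H -> isomorphic H G.
Proof.
move=> [f [[g fK gK] fE]]; exists g.
by split=> [|x y]; [exists f | rewrite -fE !gK].
Qed.

Lemma isomorphic_trans (G H K : sgraph) :
  isomorphic G H -> isomorphic H K -> isomorphic G K.
Proof.
move=> [f [fb fE]] [g [gb gE]]; exists (g \o f).
by split=> [|x y]; [exact: bij_comp | rewrite -fE -gE].
Qed.

Lemma isomorphic_of_rel (G H : sgraph) (R : G -> H -> Prop) :
  (forall x, exists y, R x y) -> (forall y, exists x, R x y) ->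
  (forall x y x' y', R x y -> R x' y' -> (x = x' <-> y = y')) ->
  (forall x y x' y', R x y -> R x' y' -> adj x x' = adj y y') ->
  isomorphic G H.
Proof.
move=> tG tH inj adjR.
have [f Rf] := choice tG; have [g Rg] := choice tH.
exists f; split=> [|x y]; last by rewrite -(adjR _ _ _ _ (Rf x) (Rf y)).
exists g => z.
  by apply/(inj _ _ _ _ (Rg (f z)) (Rf z)).
by apply/(inj _ _ _ _ (Rf (g z)) (Rg z)).
Qed.

(** Quantifying over unions of components instead of walks makes connectedness
    directly usable as an induction principle. The empty graph is connected. *)
Definition connected (G : sgraph) : Prop :=
  forall S : G -> Prop, (forall x y, adj x y -> S x -> S y) ->
  forall x y, S x -> S y.

(** [j] identifies [G] with a union of connected components of [H]; this covers
    isomorphisms and the two inclusions into a disjoint union. *)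
Definition closed_embedding (G H : sgraph) (j : G -> H) : Prop :=
  [/\ injective j, forall x y, adj (j x) (j y) = adj x y
    & forall x w, adj (j x) w -> exists y, w = j y].

Lemma iso_closed_embedding (G H : sgraph) (f : G -> H) :
  graph_iso f -> closed_embedding f.
Proof.
move=> [[g fK gK] fE]; split=> //; first exact: can_inj fK.
by move=> x w _; exists (g w); rewrite gK.
Qed.

Lemma closed_embedding_comp (G H K : sgraph) (i : G -> H) (j : H -> K) :
  closed_embedding i -> closed_embedding j -> closed_embedding (j \o i).
Proof.
move=> [ii iE ic] [ji jE jc]; split=> [|x y|x w /=]; first exact: inj_comp.
  by rewrite /= jE iE.
move=> xw; have [y wy] := jc _ _ xw; rewrite wy jE in xw.
by have [z yz] := ic _ _ xw; exists z; rewrite wy yz.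
Qed.

(** * Disjoint unions *)

Definition gsum_adj (G H : sgraph) : rel (G + H)%type := fun x y =>
  match x, y with
  | inl a, inl b => adj a b
  | inr a, inr b => adj a b
  | _, _ => false
  end.

Fact gsum_adj_sym (G H : sgraph) : symmetric (@gsum_adj G H).
Proof. by case=> x [] y //=; rewrite adj_sym. Qed.

Fact gsum_adj_irr (G H : sgraph) : irreflexive (@gsum_adj G H).
Proof. by case=> x //=; rewrite adj_irr. Qed.

Definition gsum (G H : sgraph) : sgraph :=
  SGraph (@gsum_adj_sym G H) (@gsum_adj_irr G H).

Lemma gsum_inl_embedding (G H : sgraph) :
  closed_embedding (inl : G -> gsum G H).
Proof. by split=> // [x y [] //|x [] // y _]; exists y. Qed.

Lemma gsum_inr_embedding (G H : sgraph) :
  closed_embedding (inr : H -> gsum G H).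
Proof. by split=> // [x y [] //|x [] // y _]; exists y. Qed.

Lemma gsum_isomorphic (G G' H H' : sgraph) :
  isomorphic G G' -> isomorphic H H' -> isomorphic (gsum G H) (gsum G' H').
Proof.
move=> [f [[f' fK f'K] fE]] [g [[g' gK g'K] gE]].
exists (fun x => match x with inl a => inl (f a) | inr b => inr (g b) end).
split=> [|[x|x] [y|y] //=].
exists (fun x => match x with inl a => inl (f' a) | inr b => inr (g' b) end).
- by case=> x; rewrite ?fK ?gK.
- by case=> x; rewrite ?f'K ?g'K.
Qed.

(** An isomorphism of [G + K] with [H + K] sends the connected graph [K] either
    onto [K], and then restricts to [G -> H], or into [H]; in the second case the
    vertices of [G] that it sends into [K] are sent into [H] by applying it
    twice. *)
Lemma gsum_cancel (G H K : sgraph) :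
  connected K -> (forall f : K -> K, injective f -> bijective f) ->
  isomorphic (gsum G K) (gsum H K) -> isomorphic G H.
Proof.
move=> conK finK [f [[g fK gK] fE]].
pose R x y := f (inl x) = inl y \/
  exists2 k, f (inl x) = inr k & f (inr k) = inl y.
have gP x y : g x = y -> f y = x by move=> <-.
have [tG tH] : (forall x, exists y, R x y) /\ (forall y, exists x, R x y).
  have [[k [k' fk]]|nk] := pselect (exists k k', f (inr k) = inr k').
    have fr : forall k, exists k', f (inr k) = inr k'.
      move=> k1; apply: (conK (fun k => exists k', f (inr k) = inr k') _ k).
        move=> a b ab [a' fa]; case fb: (f (inr b)) => [b'|b']; last by exists b'.
        by have := fE (inr a) (inr b); rewrite fa fb /= ab.
      by exists k'.
    have [h hP] := choice fr.
    have hinj : injective h.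
      move=> a b hab; have := hP a; rewrite hab -hP => /(can_inj fK).
      by case.
    have [h' _ h'K] := finK h hinj; split=> [x|y].
      case fx: (f (inl x)) => [y|k1]; first by exists y; left.
      by have := hP (h' k1); rewrite h'K -fx => /(can_inj fK).
    case gy: (g (inl y)) => [x|k1]; first by exists x; left; exact: gP.
    by have := hP k1; rewrite (gP _ _ gy).
  have fr k : exists y, f (inr k) = inl y.
    by case fk: (f (inr k)) => [y|k']; [exists y | case: nk; exists k, k'].
  split=> [x|y].
    case fx: (f (inl x)) => [y|k]; first by exists y; left.
    by have [y fk] := fr k; exists y; right; exists k.
  case gy: (g (inl y)) => [x|k]; first by exists x; left; exact: gP.
  case gk: (g (inr k)) => [x|k']; last by case: nk; exists k', k; exact: gP.
  by exists x; right; exists k; exact: gP.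
have fI := can_inj fK.
apply: (@isomorphic_of_rel _ _ R) => // x y x' y'.
  move=> [fx|[k fx fk]] [fx'|[k' fx' fk']]; split=> e.
  - by move: fx; rewrite e fx' => -[].
  - by move: fx; rewrite e -fx' => /fI[].
  - by move: fx; rewrite e fx'.
  - by move: fx; rewrite e -fk' => /fI.
  - by move: fx; rewrite e fx'.
  - by move: fk; rewrite e -fx' => /fI.
  - by move: fk; move: fx; rewrite e fx' => -[<-]; rewrite fk' => -[].
  - move: fk; rewrite e -fk' => /fI[kk]; move: fx; rewrite kk -fx' => /fI.
    by case.
move=> [fx|[k fx fk]] [fx'|[k' fx' fk']].
- by have := fE (inl x) (inl x'); rewrite fx fx'.
- have := fE (inl x) (inl x'); rewrite fx fx' /= => <-.
  by have := fE (inl x) (inr k'); rewrite fx fk' /= => ->.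
- have := fE (inl x) (inl x'); rewrite fx fx' /= => <-.
  by have := fE (inr k) (inl x'); rewrite fk fx' /= => ->.
- have := fE (inl x) (inl x'); rewrite fx fx' /= => <-.
  by have := fE (inr k) (inr k'); rewrite fk fk' /= => ->.
Qed.

(** * Balls and charts *)

Section Balls.
Variable G : sgraph.
Implicit Types (v w : G) (k r : nat).

Lemma gball0 v w : gball 0 v w -> w = v.
Proof. by move=> [[|a p] //= []]. Qed.

Lemma gball_step k v w w' : gball k v w -> adj w w' -> gball k.+1 v w'.
Proof.
move=> [p [pp lp sp]] ww'; exists (rcons p w').
by rewrite rcons_path pp lp ww' last_rcons size_rcons ltnS.
Qed.

Lemma gballS k v w : gball k.+1 v w ->
  w = v \/ exists2 w', gball k v w' & adj w' w.
Proof.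
move=> [p []]; elim/last_ind: p => [|p x _]; first by left.
rewrite rcons_path last_rcons size_rcons ltnS => /andP[pp px] <- sp; right.
by exists (last v p) => //; exists p.
Qed.

Lemma gball_le k r v w : (k <= r)%N -> gball k v w -> gball r v w.
Proof. by move=> kr [p [pp lp sp]]; exists p; split=> //; apply: leq_trans kr. Qed.

End Balls.

(** Walks that start at [f x] lift to walks of the same length, edge by edge. *)
Lemma gball_image (G H : sgraph) (f : G -> H) :
  (forall x y, adj x y -> adj (f x) (f y)) ->
  (forall x w, adj (f x) w -> exists2 y, adj x y & f y = w) ->
  forall r x w, gball r (f x) w <-> exists2 y, gball r x y & f y = w.
Proof.
move=> fE fL r x w; split.
  elim: r w => [|r IHr] w.
    by move/gball0->; exists x => //; exact: gball_center.
  move/gballS=> [->|[w' /IHr[y xy <-] yw]]; first by exists x => //; exact: gball_center.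
  by have [z yz <-] := fL _ _ yw; exists z => //; apply: gball_step yz.
move=> [y xy <-]; elim: r y xy => [|r IHr] y.
  by move/gball0->; exact: gball_center.
move/gballS=> [->|[z xz zy]]; first exact: gball_center.
by apply: gball_step (fE _ _ zy); apply: IHr.
Qed.

Lemma gball_embedding (G H : sgraph) (j : G -> H) (r : nat) (x : G) (w : H) :
  closed_embedding j ->
  gball r (j x) w <-> exists2 y, gball r x y & j y = w.
Proof.
move=> [ji jE jc]; apply: gball_image => [y z|y z yz]; first by rewrite jE.
by have [t zt] := jc _ _ yz; exists t; rewrite ?zt // -jE -zt.
Qed.

(** The restriction of [f] to the ball of radius [r] around [u] is a pointed
    isomorphism onto the ball around [v]; unlike the map between links, [f] is
    defined everywhere. *)
Definition chart (F G : sgraph) (u : F) (r : nat) (v : G) (f : F -> G) : Prop :=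
  [/\ f u = v,
      forall x y, gball r u x -> gball r u y -> f x = f y -> x = y,
      forall x y, gball r u x -> gball r u y -> adj (f x) (f y) = adj x y
    & forall w, gball r v w <-> exists2 x, gball r u x & f x = w].

(** Links are types of dependent pairs; charts avoid their membership proofs. *)
Lemma locally_chart (F : sgraph) (u : F) (r : nat) (G : sgraph) :
  locally u r G <-> forall v : G, exists f : F -> G, chart u r v f.
Proof.
split=> loc v.
  have [phi [[[psi phiK psiK] phiE] phi0]] := loc v.
  pose f x := if pselect (gball r u x) is left xP
    then val (phi (exist _ x (mem_set xP))) else v.
  have fE x (xP : gball r u x) : f x = val (phi (exist _ x (mem_set xP))).
    by rewrite /f; case: pselect => // xP'; rewrite (Prop_irrelevance xP' xP).
  exists f; split.
  - by rewrite (fE _ (gball_center r u)) -/(link_center r u) phi0.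
  - move=> x y xP yP; rewrite (fE _ xP) (fE _ yP) => /val_inj/(can_inj phiK).
    by move/(congr1 val).
  - move=> x y xP yP; rewrite (fE _ xP) (fE _ yP).
    exact: (phiE (exist _ x (mem_set xP)) (exist _ y (mem_set yP))).
  - move=> w; split=> [wP|[x xP <-]]; last first.
      by rewrite (fE _ xP); apply: set_mem; exact: valP.
    have xP := set_mem (valP (psi (exist _ w (mem_set wP)))).
    exists (val (psi (exist _ w (mem_set wP)))) => //; rewrite (fE _ xP).
    rewrite [exist _ _ _](_ : _ = psi (exist _ w (mem_set wP))) ?psiK //.
    exact: val_inj.
have [f [f0 fI fE fS]] := loc v.
have fP (x : link r u) : f (val x) \in gball r v.
  by apply: mem_set; apply/fS; exists (val x) => //; apply: set_mem; exact: valP.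
have uP (x : link r u) : gball r u (val x) by apply: set_mem; exact: valP.
have /choice[psi psiP] (w : link r v) : exists x : link r u, f (val x) = val w.
  have /fS[x xP xw] : gball r v (val w) by apply: set_mem; exact: valP.
  by exists (exist _ x (mem_set xP)).
exists (fun x => exist _ (f (val x)) (fP x)); split; last exact: val_inj.
split=> [|x y]; last exact: fE.
exists psi => w; apply: val_inj; last exact: psiP.
by apply: fI => //; rewrite psiP.
Qed.

(** The ball around [j v] stays inside the image of [j]. *)
Lemma locally_embedding (F : sgraph) (u : F) (r : nat) (G H : sgraph)
    (j : G -> H) : closed_embedding j -> locally u r H -> locally u r G.
Proof.
move=> ej /locally_chart loc; apply/locally_chart => v.
have [f [f0 fI fE fS]] := loc (j v); have [ji jE _] := ej.
have /choice[g gP] x : exists y, gball r u x -> j y = f x /\ gball r v y.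
  have [xP|nP] := pselect (gball r u x); last by exists v.
  have /(gball_embedding _ _ _ ej)[y vy yx] : gball r (j v) (f x) by apply/fS; exists x.
  by exists y => _; split.
have uu := gball_center r u.
exists g; split.
- by apply: ji; have [-> _] := gP _ uu.
- by move=> x y xP yP gxy; apply: fI => //; rewrite -(gP x xP).1 -(gP y yP).1 gxy.
- by move=> x y xP yP; rewrite -jE (gP x xP).1 (gP y yP).1 fE.
- move=> w; split=> [vw|[x xP <-]]; last by have [] := gP x xP.
  have /fS[x xP fx] : gball r (j v) (j w) by apply/(gball_embedding _ _ _ ej); exists w.
  by exists x => //; apply: ji; rewrite (gP x xP).1.
Qed.

Lemma locally_glue (F : sgraph) (u : F) (r : nat) (H : sgraph) :
  (forall w : H, exists (G : sgraph) (j : G -> H) (x : G),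
     [/\ closed_embedding j, locally u r G & w = j x]) -> locally u r H.
Proof.
move=> loc; apply/locally_chart => w; have [G [j [x [ej /locally_chart lG ->]]]] := loc w.
have [f [f0 fI fE fS]] := lG x; have [ji jE _] := ej.
exists (j \o f); split=> [|y z yP zP /ji|y z yP zP|z] /=.
- by rewrite f0.
- exact: fI.
- by rewrite jE fE.
- split=> [/(gball_embedding _ _ _ ej)[y /fS[t tP ty] yz]|[t tP tz]].
    by exists t; rewrite // ty.
  by apply/(gball_embedding _ _ _ ej); exists (f t) => //; apply/fS; exists t.
Qed.

Lemma locally_isomorphic (F : sgraph) (u : F) (r : nat) (G H : sgraph) :
  isomorphic G H -> locally u r H -> locally u r G.
Proof. by move=> [f /iso_closed_embedding]; exact: locally_embedding. Qed.

Lemma locally_gsum (F : sgraph) (u : F) (r : nat) (G H : sgraph) :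
  locally u r G -> locally u r H -> locally u r (gsum G H).
Proof.
move=> lG lH; apply: locally_glue => -[x|x].
  by exists G, inl, x; split=> //; exact: gsum_inl_embedding.
by exists H, inr, x; split=> //; exact: gsum_inr_embedding.
Qed.

(** * Squares in graphs that are locally a lattice *)

Definition dir (d : nat) : Type := ('I_d * bool)%type.
HB.instance Definition _ d := Finite.on (dir d).

Definition odir d (a : dir d) : dir d := (a.1, ~~ a.2).

Definition uv d (a : dir d) : 'rV[int]_d :=
  if a.2 then unit_vec a.1 else - unit_vec a.1.

Section Directions.
Variable d : nat.
Implicit Types a b c e : dir d.

Lemma odirK : involutive (@odir d).
Proof. by case=> i b; rewrite /odir /= negbK. Qed.

Lemma odir_neq a : odir a <> a.
Proof. by case: a => i []. Qed.

Lemma uv_odir a : uv (odir a) = - uv a.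
Proof. by case: a => i [] //=; rewrite /uv /= opprK. Qed.

Lemma uvE a j : uv a 0 j = if a.1 == j then (if a.2 then 1 else -1) else 0.
Proof. by rewrite /uv eq_sym; case: a.2; rewrite !mxE eqxx /=; case: eqP. Qed.

Lemma uv_inj : injective (@uv d).
Proof.
move=> [i b] [j c] /matrixP e; have := e 0 i; have := e 0 j; clear e.
rewrite !uvE /= !eqxx; case: eqVneq => [->|_]; last by case: c.
by case: b; case: c => //; rewrite eqxx.
Qed.

Lemma uvD_eq0 a b : uv a + uv b = 0 -> b = odir a.
Proof. by move=> h; apply: uv_inj; rewrite uv_odir -[LHS](addKr (uv a)) h addr0. Qed.

(** Everything that is used about distances in the lattice reduces to this:
    two steps and two steps that lead to the same point are the same up to order,
    unless they lead back to the start. *)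
Lemma uvD_eq a b c e : uv a + uv b = uv c + uv e ->
  [\/ a = c /\ b = e, a = e /\ b = c | b = odir a /\ e = odir c].
Proof.
move=> h; have [ac|ac] := eqVneq a c.
  by constructor 1; split=> //; apply: uv_inj; apply: (addrI (uv a)); rewrite h ac.
have [ae|ae] := eqVneq a e.
  constructor 2; split=> //; apply: uv_inj; apply: (addrI (uv a)).
  by rewrite h ae addrC.
constructor 3; suff bE : b = odir a.
  by split=> //; apply: uvD_eq0; rewrite -h bE uv_odir subrr.
have /matrixP/(_ 0 a.1) := h; rewrite !mxE !uvE eqxx.
case: a b c e ac ae {h} => [i x] [j y] [k z] [l t]; rewrite /odir !xpair_eqE /=.
rewrite ![_ == i]eq_sym.
by case: (eqVneq i j) => [<-|_]; case: (eqVneq i k) => _; case: (eqVneq i l) => _;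
  case: x; case: y; case: z; case: t.
Qed.

Lemma lattice_adjP (x y : lattice d) :
  reflect (exists a, y = x + uv a) (adj x y).
Proof.
apply: (iffP existsP) => [[i /orP[]/eqP->]|[[i []] ->]].
- by exists (i, true).
- by exists (i, false); rewrite /uv /= addrK.
- by exists i; rewrite /uv /= eqxx.
- by exists i; rewrite /uv /= subrK eqxx orbT.
Qed.

Lemma adj_uv (x : lattice d) a : adj x (x + uv a).
Proof. by apply/lattice_adjP; exists a. Qed.

Lemma lattice_ind (P : 'rV[int]_d -> Prop) :
  P 0 -> (forall x a, P x -> P (x + uv a)) -> forall x, P x.
Proof.
move=> P0 PS x; rewrite [x]row_sum_delta.
elim: (index_enum _) => [|i l IHl]; first by rewrite big_nil.
rewrite big_cons addrC.
have PZ n (s : bool) y : P y -> P (y + uv (i, s) *+ n).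
  move=> Py; elim: n => [|n IHn]; first by rewrite addr0.
  by rewrite mulrSr addrA; exact: PS.
case: (x 0 i) => n.
  by have := PZ n true _ IHl; rewrite /uv /= -scaler_nat -[n%:R]/(n%:R) natz.
by have := PZ n.+1 false _ IHl; rewrite /uv /= -scaler_nat NegzE natz scaleNr scalerN.
Qed.

End Directions.

Section Squares.
Variable G : sgraph.
Implicit Types v w a b c z : G.

(** [v a z b] is a 4-cycle. *)
Definition square v a b z : Prop :=
  [/\ adj v a, adj v b, adj a z, adj b z & a <> b /\ v <> z].

(** In a lattice, the pairs [x + u], [x - u] of neighbours of [x] are those that
    span no square with [x]. *)
Definition opposite v a b : Prop :=
  [/\ adj v a, adj v b, a <> b & forall z, ~ square v a b z].

Definition frame d v (F : dir d -> G) : Prop :=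
  [/\ forall i, adj v (F i), injective F,
      forall i, opposite v (F i) (F (odir i))
    & forall w, adj v w -> exists i, w = F i].

Lemma square_sym v a b z : square v a b z -> square v b a z.
Proof. by move=> [va vb az bz [ab vz]]; split=> //; split=> // /esym. Qed.

Lemma square_rot v a b z : square v a b z -> square a v z b.
Proof.
by move=> [va vb az bz [ab vz]]; split=> //; rewrite adj_sym.
Qed.

Lemma opposite_sym v a b : opposite v a b -> opposite v b a.
Proof.
by move=> [va vb ab ns]; split=> // [/esym //|z /square_sym]; exact: ns.
Qed.

Lemma opposite_or_square v a b : adj v a -> adj v b -> a <> b ->
  opposite v a b \/ exists z, square v a b z.
Proof.
move=> va vb ab; have [s|ns] := pselect (exists z, square v a b z); first by right.
by left; split=> // z vz; apply: ns; exists z.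
Qed.

End Squares.

(** The only consequences of being locally a lattice on which the covering by the
    lattice relies. *)
Record lattice_like (d : nat) (G : sgraph) : Prop := LatticeLike {
  ex_frame : forall v : G, exists F : dir d -> G, frame v F;
  square_uniq : forall v a b z z' : G,
    square v a b z -> square v a b z' -> z = z';
  opposite_uniq : forall v a b b' : G,
    opposite v a b -> opposite v a b' -> b = b';
  opposite_transport : forall v w x x' y y' : G,
    opposite v x x' -> square v w x y -> square v w x' y' -> opposite w y y';
  cube_closes : forall v a b c x y z s : G,
    square v a b z -> square v a c y -> square v b c x ->
    square a z y s -> square b z x s }.

Section LocallyLattice.
Variables (d r : nat) (G : sgraph).
Hypothesis r_ge2 : (2 <= r)%N.

Section Chart.
Variables (v : G) (f : 'rV[int]_d -> G).
Hypothesis fP : chart (0 : lattice d) r v f.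

Let ball1 (a : dir d) : gball 1 (0 : lattice d) (uv a).
Proof. by apply: gball_step (gball_center 0 _) _; rewrite -[uv a]add0r; exact: adj_uv. Qed.

Let ball2 (a b : dir d) : gball 2 (0 : lattice d) (uv a + uv b).
Proof. by apply: gball_step (ball1 a) (adj_uv _ _). Qed.

Let ball3 (a b c : dir d) : gball 3 (0 : lattice d) (uv a + uv b + uv c).
Proof. by apply: gball_step (ball2 a b) (adj_uv _ _). Qed.

Lemma chart_ball k (p : lattice d) : (k <= r)%N ->
  gball k (0 : lattice d) p -> gball k v (f p).
Proof.
have [f0 _ fE _] := fP; elim: k p => [|k IHk] p kr.
  by move/gball0->; rewrite f0; exact: gball_center.
move/gballS=> [->|[q kq qp]]; first by rewrite f0; exact: gball_center.
apply: gball_step (IHk _ (ltnW kr) kq) _; rewrite fE //.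
  exact: gball_le (ltnW kr) kq.
by apply: gball_le kr _; exact: gball_step kq qp.
Qed.

Lemma chart_adj k (p : lattice d) t : (k < r)%N -> gball k (0 : lattice d) p ->
  adj (f p) t <-> exists a, t = f (p + uv a).
Proof.
move=> kr kp; have [f0 _ fE fS] := fP; have rp := gball_le (ltnW kr) kp.
have rpa a : gball r (0 : lattice d) (p + uv a).
  by apply: gball_le kr _; apply: gball_step kp (adj_uv _ _).
split=> [pt|[a ->]]; last by rewrite fE // adj_uv.
have /fS[q rq qt] : gball r v t.
  by apply: (gball_le kr); apply: gball_step pt; exact: chart_ball (ltnW kr) kp.
have /lattice_adjP[a qE] : adj p q by rewrite -fE // qt.
by exists a; rewrite -qt qE.
Qed.

Let r1 : (0 < r)%N. Proof. exact: leq_trans r_ge2. Qed.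

Lemma chart_adj0 t : adj v t <-> exists a, t = f (uv a).
Proof.
have [f0 _ _ _] := fP; rewrite -f0; rewrite (chart_adj _ r1 (gball_center 0 _)).
by split=> -[a ->]; exists a; rewrite ?add0r.
Qed.

Lemma chart_adj1 a t : adj (f (uv a)) t <-> exists b, t = f (uv a + uv b).
Proof. exact: chart_adj (ball1 a). Qed.

Let adj0 a : adj v (f (uv a)). Proof. by apply/chart_adj0; exists a. Qed.

Let adj1 a b : adj (f (uv a)) (f (uv a + uv b)).
Proof. by apply/chart_adj1; exists b. Qed.

Lemma chart_inj2 a b a' b' : f (uv a + uv b) = f (uv a' + uv b') ->
  uv a + uv b = uv a' + uv b'.
Proof. by have [_ fI _ _] := fP; apply: fI; exact: (gball_le r_ge2 (ball2 _ _)). Qed.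

Lemma chart_inj1 a b : f (uv a) = f (uv b) -> a = b.
Proof.
have [_ fI _ _] := fP => /fI e; apply: uv_inj; apply: e;
  exact: (gball_le r1 (ball1 _)).
Qed.

Lemma chart_inj0 a b : v = f (uv a + uv b) -> b = odir a.
Proof.
have [f0 fI _ _] := fP; rewrite -f0 => /fI e; apply: uvD_eq0; rewrite -e //.
  exact: gball_center.
exact: (gball_le r_ge2 (ball2 a b)).
Qed.

Lemma chart_square a b z :
  square v (f (uv a)) (f (uv b)) z <->
  [/\ b <> a, b <> odir a & z = f (uv a + uv b)].
Proof.
split=> [[_ _ /chart_adj1[c zac] /chart_adj1[e zbe] [ab vz]]|[ba nba ->]].
  have ba : b <> a by move=> e'; rewrite e' in ab.
  have zE : z = f (uv a + uv b).
    have /uvD_eq[[/esym //]|[_ <-] //|[ca _]] := chart_inj2 (etrans (esym zac) zbe).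
    by case: vz; rewrite zac ca uv_odir subrr; case: fP.
  by split=> // bE; apply: vz; rewrite zE bE uv_odir subrr; case: fP.
split; [exact: adj0|exact: adj0|exact: adj1|by rewrite addrC; exact: adj1|].
by split=> [/chart_inj1/esym|/chart_inj0].
Qed.

Lemma chart_opposite a b :
  opposite v (f (uv a)) (f (uv b)) <-> b = odir a.
Proof.
split=> [[_ _ ab ns]|->].
  have [//|nba] := eqVneq b (odir a); case: (ns (f (uv a + uv b))).
  by apply/chart_square; split=> //; [move=> e; rewrite e in ab | exact/eqP].
split; [exact: adj0|exact: adj0|by move/chart_inj1/esym; exact: odir_neq|].
by move=> z /chart_square[].
Qed.

Lemma chart_frame : frame v (fun a => f (uv a)).
Proof.
split=> [a|a b|a|w]; last by move/chart_adj0.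
- exact: adj0.
- exact: chart_inj1.
- exact/chart_opposite.
Qed.

Hypothesis r_ge3 : (3 <= r)%N.

Lemma chart_adj2 a b t :
  adj (f (uv a + uv b)) t <-> exists c, t = f (uv a + uv b + uv c).
Proof. exact: chart_adj (ball2 a b). Qed.

Lemma chart_inj3 a b c a' b' c' :
  f (uv a + uv b + uv c) = f (uv a' + uv b' + uv c') ->
  uv a + uv b + uv c = uv a' + uv b' + uv c'.
Proof. by have [_ fI _ _] := fP; apply: fI; exact: (gball_le r_ge3 (ball3 _ _ _)). Qed.

Lemma chart_inj13 a b c : f (uv a) = f (uv b + uv a + uv c) -> c = odir b.
Proof.
have [_ fI _ _] := fP => /fI e; apply: uvD_eq0; apply: (addrI (uv a)).
rewrite addr0 addrA [uv a + _]addrC -e //; first exact: (gball_le r1 (ball1 a)).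
exact: (gball_le r_ge3 (ball3 _ _ _)).
Qed.

(** The common neighbours of two neighbours of [f (uv a)] may lie at distance 3
    from [v]. *)
Lemma chart_opposite1 a b : b <> a -> b <> odir a ->
  opposite (f (uv a)) (f (uv a + uv b)) (f (uv a + uv (odir b))).
Proof.
move=> ba nba; split; [exact: adj1|exact: adj1| |].
  by move/chart_inj2/addrI/uv_inj/esym; exact: odir_neq.
move=> z [_ _ /chart_adj2[c zc] /chart_adj2[e ze] [_ az]].
have := chart_inj3 (etrans (esym zc) ze); rewrite -!addrA => /addrI.
have caz : c <> odir b.
  by move=> cb; apply: az; rewrite zc cb uv_odir addrK.
by case/uvD_eq=> [[/esym/odir_neq]|[_ /caz]|[/caz]].
Qed.

Lemma chart_cube a b c s : b <> a -> b <> odir a -> c <> a -> c <> odir a ->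
  c <> b -> c <> odir b ->
  square (f (uv a)) (f (uv a + uv b)) (f (uv a + uv c)) s ->
  square (f (uv b)) (f (uv a + uv b)) (f (uv b + uv c)) s.
Proof.
move=> ba nba ca nca cb ncb [_ _ zs /chart_adj2[e ys] [_ as_]].
have /chart_adj2[g zg] := zs.
have sE : s = f (uv a + uv b + uv c).
  have := chart_inj3 (etrans (esym zg) ys); rewrite -!addrA => /addrI.
  case/uvD_eq=> [[bc]|[_ gc]|[gb _]].
  - by rewrite bc in cb.
  - by rewrite zg gc addrA.
  by case: as_; rewrite zg gb uv_odir addrK.
split=> //; [by rewrite addrC; exact: adj1| |].
  by apply/chart_adj2; exists a; rewrite sE -addrA addrC.
split=> [/chart_inj2|]; first by rewrite addrC => /addrI/uv_inj/esym.
by rewrite sE => /chart_inj13.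
Qed.

End Chart.

Hypothesis d_r : d = 2%N \/ (3 <= r)%N.
Hypothesis loc : locally (0 : lattice d) r G.

Let dir_neq (a b : dir d) : b <> a -> b <> odir a -> b.1 <> a.1.
Proof.
case: a b => [i x] [j y] /= n1 n2 ij; move: n1 n2; rewrite ij /odir /=.
by case: x y => [] [].
Qed.

Let ord2_eq (i j k : 'I_d) : d = 2%N -> j <> i -> k <> i -> j = k.
Proof.
move=> d2 ji ki; apply: val_inj; move: i j k ji ki; rewrite d2.
by move=> -[[|[|i]] hi] // [[|[|j]] hj] // [[|[|k]] hk] //= ji ki;
  solve [case: ji; exact: val_inj | case: ki; exact: val_inj].
Qed.

(** In a chart around [v], a square at [v] is spanned by two non-opposite
    directions, and its fourth vertex is the sum. The preservation of opposite
    neighbours under transport, and the closing of cubes, involve vertices at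
    distance 3 from [v], hence the radius 3. In dimension 2 there are no cubes, and
    opposite neighbours are preserved because four neighbours of [w] leave only one
    way to pair the two that are neither [v] nor opposite to [v]. *)
Lemma locally_lattice_like : lattice_like d G.
Proof.
move/locally_chart: loc => ch.
have exF v : exists F : dir d -> G, frame v F.
  by have [f fP] := ch v; exists (fun a => f (uv a)); exact: chart_frame.
have sqU (v a b z z' : G) : square v a b z -> square v a b z' -> z = z'.
  have [f fP] := ch v => s1 s2; have [va vb _ _ _] := s1.
  have [/(chart_adj0 fP)[a' ea] /(chart_adj0 fP)[b' eb]] := (va, vb).
  move: s1 s2; rewrite ea eb.
  by move=> /(chart_square fP)[_ _ ->] /(chart_square fP)[_ _ ->].
have opU (v a b b' : G) : opposite v a b -> opposite v a b' -> b = b'.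
  have [f fP] := ch v => s1 s2; have [va vb _ _] := s1; have [_ vb' _ _] := s2.
  have [/(chart_adj0 fP)[a1 ea] /(chart_adj0 fP)[b1 eb]] := (va, vb).
  have /(chart_adj0 fP)[b2 eb'] := vb'.
  move: s1 s2; rewrite ea eb eb'.
  by move=> /(chart_opposite fP)-> /(chart_opposite fP)->.
split=> // [v w x x' y y' o s s'|v a b c x y z s s1 s2 s3].
  have [f fP] := ch v.
  have [vw vx _ _ _] := s; have [_ vx' _ _ _] := s'.
  have [/(chart_adj0 fP)[a ea] /(chart_adj0 fP)[b eb]] := (vw, vx).
  have /(chart_adj0 fP)[b' eb'] := vx'.
  have [d2|r3] := d_r; last first.
    move: o s s'; rewrite ea eb eb' => /(chart_opposite fP)->.
    move=> /(chart_square fP)[ba nba ->] /(chart_square fP)[_ _ ->].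
    exact: (chart_opposite1 fP r3).
  have [_ _ _ xy [_ vy]] := s; have [_ _ _ _ [_ vy']] := s'.
  have yy' : y <> y'.
    move=> e; have [_ _ xx' /(_ y)] := o; apply.
    by split=> //; rewrite e; case: s'.
  have [F [FE FI Fo FS]] := exF w.
  have [_ wy] : adj v w /\ adj w y by case: s.
  have wy' : adj w y' by case: s'.
  have wv : adj w v by rewrite adj_sym.
  have [[[g eg] [h eh]] [h' eh']] := (FS _ wv, FS _ wy, FS _ wy').
  (* A vertex that spans a square with [v] is not opposite to [v]. *)
  have ny t t' : square v w t t' -> t' = F (odir g) -> False.
    move=> /square_rot st et; have := Fo g; rewrite -eg -et => -[_ _ _ /(_ t)].
    exact.
  have n1 : h.1 <> g.1.
    by apply: dir_neq => e;
      [apply: vy; rewrite eg eh e | apply: (ny _ _ s); rewrite eh e].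
  have n2 : h'.1 <> g.1.
    by apply: dir_neq => e;
      [apply: vy'; rewrite eg eh' e | apply: (ny _ _ s'); rewrite eh' e].
  have hh := ord2_eq d2 n1 n2.
  have -> : y' = F (odir h); last by rewrite eh.
  rewrite eh'; congr F; case: h h' hh eh eh' {n1 n2} => [i p] [j q] /= -> eh eh'.
  rewrite /odir /=; congr pair; move: yy'; rewrite eh eh'.
  by case: p q {eh eh'} => [] [] // /(_ erefl).
have [f fP] := ch v.
have [va vb _ _ _] := s1; have [_ vc _ _ _] := s2.
have [/(chart_adj0 fP)[a' ea] /(chart_adj0 fP)[b' eb]] := (va, vb).
have /(chart_adj0 fP)[c' ec] := vc.
move: s1 s2 s3; rewrite ea eb ec.
move=> /(chart_square fP)[ba nba ->] /(chart_square fP)[ca nca ->].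
move=> /(chart_square fP)[cb ncb ->].
have [d2|r3] := d_r; last exact: (chart_cube fP r3).
have e := ord2_eq d2 (dir_neq ba nba) (dir_neq ca nca).
by case: (dir_neq cb ncb).
Qed.

End LocallyLattice.

(** * Parallel transport of frames *)

Section LatticeAction.
Variables (d : nat) (X : Type) (I : X -> Prop) (T : dir d -> X -> X).
Hypothesis TI : forall a x, I x -> I (T a x).
Hypothesis TK : forall a x, I x -> T (odir a) (T a x) = x.
Hypothesis TC : forall a b x, I x -> T a (T b x) = T b (T a x).

Let zpow (i : 'I_d) (z : int) (x : X) : X :=
  match z with
  | Posz n => iter n (T (i, true)) x
  | Negz n => iter n.+1 (T (i, false)) x
  end.

Let iterI n a x : I x -> I (iter n (T a) x).
Proof. by move=> Ix; elim: n => //= n; exact: TI. Qed.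

Let zpowI i z x : I x -> I (zpow i z x).
Proof. by case: z => n Ix; exact: iterI. Qed.

Let iterC n a b x : I x -> iter n (T a) (T b x) = T b (iter n (T a) x).
Proof. by move=> Ix; elim: n => //= n ->; rewrite TC //; exact: iterI. Qed.

Let zpowC i z b x : I x -> zpow i z (T b x) = T b (zpow i z x).
Proof. by case: z => n; exact: iterC. Qed.

Let zpowD1 i z x : I x -> zpow i (z + 1) x = T (i, true) (zpow i z x).
Proof.
move=> Ix; case: z => [n|[|n]]; first by rewrite -PoszD addn1.
  by rewrite /= -[(i, true)]/(odir (i, false)) TK.
have -> : Negz n.+1 + 1 = Negz n by lia.
rewrite /= -[(i, true)]/(odir (i, false)) TK //.
by rewrite -[T _ _]/(iter n.+1 _ x); exact: iterI.
Qed.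

Let zpowB1 i z x : I x -> zpow i (z - 1) x = T (i, false) (zpow i z x).
Proof.
move=> Ix; have := @zpowD1 i (z - 1) x Ix; rewrite subrK => ->.
by rewrite -[(i, false)]/(odir (i, true)) TK //; exact: zpowI.
Qed.

(** Commuting invertible steps in the [2 d] directions make up an action of the
    lattice: apply the steps one axis after the other. *)
Lemma lattice_walk x0 : I x0 ->
  exists st : 'rV[int]_d -> X,
    [/\ st 0 = x0, forall x, I (st x) & forall x a, st (x + uv a) = T a (st x)].
Proof.
move=> I0; pose st l (x : 'rV[int]_d) := foldr (fun i s => zpow i (x 0 i) s) x0 l.
have stI l x : I (st l x) by elim: l => //= i l; exact: zpowI.
have st_out l (x : 'rV[int]_d) a : a.1 \notin l -> st l (x + uv a) = st l x.
  elim: l => //= i l IHl; rewrite inE negb_or => /andP[ai al]; rewrite IHl //.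
  by rewrite !mxE uvE (negPf ai) addr0.
exists (st (enum 'I_d)); split=> //.
  by elim: (enum _) => //= i l ->; rewrite mxE.
move=> x a; have := mem_enum 'I_d a.1; rewrite inE.
elim: (enum _) (enum_uniq 'I_d) => //= i l IHl /andP[il ul].
rewrite inE; case: eqVneq => [ai _|ai al]; last first.
  by rewrite IHl // !mxE uvE (negPf ai) addr0 zpowC.
rewrite st_out ?ai // !mxE uvE ai eqxx.
have aE : a = (i, a.2) by rewrite -ai; case: (a).
by case: (a.2) aE => ->; [rewrite zpowD1|rewrite zpowB1].
Qed.

End LatticeAction.

Section Transport.
Variables (d : nat) (G : sgraph).
Hypothesis LL : lattice_like d G.

Let ex_fourth : exists f : G * G * G -> G, forall v a b,
  (exists z, square v a b z) -> square v a b (f (v, a, b)).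
Proof.
have /choice[f fP] (p : G * G * G) : exists z, (exists z', square p.1.1 p.1.2 p.2 z')
    -> square p.1.1 p.1.2 p.2 z.
  have [[z zP]|nz] := pselect (exists z', square p.1.1 p.1.2 p.2 z').
    by exists z.
  by exists p.2 => /nz.
by exists f => v a b; exact: (fP (v, a, b)).
Qed.

Let ex_anti : exists f : G * G -> G, forall v a,
  adj v a -> opposite v a (f (v, a)).
Proof.
have /choice[f fP] (p : G * G) : exists z, adj p.1 p.2 -> opposite p.1 p.2 z.
  have [va|nz] := pselect (adj p.1 p.2); last by exists p.2.
  have [F [FE FI Fo FS]] := ex_frame LL p.1; have [i ->] := FS _ va.
  by exists (F (odir i)).
by exists f => v a; exact: (fP (v, a)).
Qed.

Definition fourth v a b := sval (cid ex_fourth) (v, a, b).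
Definition anti v a := sval (cid ex_anti) (v, a).

Lemma fourthE v a b z : square v a b z -> fourth v a b = z.
Proof.
move=> s; apply: (square_uniq LL _ s).
by apply: (svalP (cid ex_fourth)); exists z.
Qed.

Lemma antiP v a : adj v a -> opposite v a (anti v a).
Proof. exact: (svalP (cid ex_anti)). Qed.

Lemma antiE v a b : opposite v a b -> anti v a = b.
Proof.
by move=> o; have [va _ _ _] := o; exact: (opposite_uniq LL (antiP va) o).
Qed.

Definition state : Type := (G * (dir d -> G))%type.
Implicit Types (i j k : dir d) (s : state).

(** Moving a frame along the edge in direction [i]: the edge keeps its direction
    and every other edge is pushed across the square that it spans with it. *)
Definition transport i s : state :=
  (s.2 i, fun j => if j == i then anti (s.2 i) s.1
                   else if j == odir i then s.1
                   else fourth s.1 (s.2 i) (s.2 j)).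

Definition good_state s : Prop := frame s.1 s.2.

Lemma frame_opp v (F : dir d -> G) i j : frame v F ->
  opposite v (F i) (F j) -> j = odir i.
Proof.
by move=> [_ FI Fo _] o; apply: FI; exact: (opposite_uniq LL o (Fo i)).
Qed.

Lemma frame_square v (F : dir d -> G) i j : frame v F -> j <> i -> j <> odir i ->
  square v (F i) (F j) (fourth v (F i) (F j)).
Proof.
move=> fF ji nji; have [FE FI _ _] := fF.
have [|[z sz]] := opposite_or_square (FE i) (FE j) (fun e => ji (esym (FI _ _ e))).
  by move/(frame_opp fF).
by rewrite (fourthE sz).
Qed.

Lemma transport_dir i s : (transport i s).2 i = anti (s.2 i) s.1.
Proof. by rewrite /transport /= eqxx. Qed.

Lemma transport_odir i s : (transport i s).2 (odir i) = s.1.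
Proof. by rewrite /transport /= eqxx; case: eqP => // /odir_neq. Qed.

Lemma transport_other i j s : j <> i -> j <> odir i ->
  (transport i s).2 j = fourth s.1 (s.2 i) (s.2 j).
Proof. by rewrite /transport /=; case: eqP => //; case: eqP. Qed.

Lemma dir_case i j (P : Prop) :
  (j = i -> P) -> (j = odir i -> P) -> (j <> i -> j <> odir i -> P) -> P.
Proof. by case: (eqVneq j i) => [|/eqP]; case: (eqVneq j (odir i)) => [|/eqP]; auto. Qed.

Lemma odir_neq_odir i j : j <> i -> odir j <> odir i.
Proof. by move=> ji /(can_inj (@odirK d)). Qed.

Lemma neq_odir i j : j <> odir i -> odir j <> i.
Proof. by move=> ji e; apply: ji; rewrite -e odirK. Qed.

(** Opposite pairs are preserved by [opposite_transport]. A direction other than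
    [i] and its opposite is sent to a vertex that spans a square with [v], hence
    neither to [v] nor to the neighbour opposite to [v]. *)
Lemma transport_frame i s : good_state s -> good_state (transport i s).
Proof.
case: s => v F; rewrite /good_state /= => fF; have [FE FI Fo FS] := fF.
set w := F i; set F' := (transport i (v, F)).2.
rewrite -/F' -[fun _ => _]/F'.
have wv : adj w v by rewrite adj_sym FE.
have FiE : F' i = anti w v by rewrite /F' transport_dir.
have FoE : F' (odir i) = v by rewrite /F' transport_odir.
have sqF j : j <> i -> j <> odir i -> square v w (F j) (F' j).
  by move=> ji nji; rewrite /F' transport_other //; exact: frame_square.
have oF : opposite w (F' i) (F' (odir i)).
  by rewrite FiE FoE; apply: opposite_sym; exact: antiP.
have F'E j : adj w (F' j).
  apply: (@dir_case i j) => [->|->|ji nji]; [by case: oF|by rewrite FoE|].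
  by case: (sqF _ ji nji).
have F'o j : opposite w (F' j) (F' (odir j)).
  apply: (@dir_case i j) => [->//|->|ji nji]; first by rewrite odirK; exact: opposite_sym.
  apply: (opposite_transport LL) (Fo j) (sqF _ ji nji) (sqF _ _ _).
    exact: neq_odir.
  exact: odir_neq_odir.
have nov j : j <> i -> j <> odir i -> F' j <> v.
  by move=> ji nji; have [_ _ _ _ [_ /nesym]] := sqF _ ji nji.
have noa j : j <> i -> j <> odir i -> F' j <> F' i.
  move=> ji nji e; have [_ _ _] := oF; rewrite -e FoE => /(_ (F j)); apply.
  exact/square_sym/square_rot/sqF.
have via : F' i <> v by rewrite -FoE; case: oF.
(* Two squares with three consecutive vertices in common coincide. *)
have F'I : injective F'.
  move=> j k; apply: (@dir_case i j) => [->|->|ji nji];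
    apply: (@dir_case i k) => [->|->|ki nki] //.
  - by rewrite FoE.
  - by move=> e; case: (noa _ ki nki).
  - by rewrite FoE => /esym.
  - by rewrite FoE => /esym/nov; case.
  - by move/noa; case.
  - by rewrite FoE => /nov; case.
  move=> e; apply: FI.
  have s1 := square_rot (sqF _ ji nji); have s2 := square_rot (sqF _ ki nki).
  by rewrite e in s1; exact: (square_uniq LL s1 s2).
(* An injective labelling is onto, since some frame shows that there are as many
   neighbours as directions. *)
split=> // x wx; have [H [HE HI Ho HS]] := ex_frame LL w.
have /choice[h hP] j : exists k, F' j = H k by exact: HS.
have hI : injective h by move=> j k e; apply: F'I; rewrite !hP e.
have [h' _ h'K] := injF_bij hI.
by have [k ->] := HS _ wx; exists (h' k); rewrite hP h'K.
Qed.

Lemma transportK i s : good_state s -> transport (odir i) (transport i s) = s.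
Proof.
case: s => v F fF; have fF' := transport_frame i fF; have [FE FI Fo FS] := fF.
rewrite [LHS]surjective_pairing; congr pair.
  exact: transport_odir.
have vw : opposite v (F i) (F (odir i)) := Fo i.
apply/funext => j; apply: (@dir_case i j) => [->|->|ji nji].
- by have := transport_odir (odir i) (transport i (v, F)); rewrite odirK => ->.
- by rewrite transport_dir transport_odir /=; exact: antiE.
rewrite transport_other ?odirK // transport_odir transport_other //.
exact/fourthE/square_rot/frame_square.
Qed.

Lemma transport_vertex i j s : good_state s -> j <> i -> j <> odir i ->
  (transport i (transport j s)).1 = fourth s.1 (s.2 i) (s.2 j).
Proof.
move=> gs ji nji; rewrite [LHS]/= -[LHS]/((transport j s).2 i).
have nij : i <> odir j by move=> e; apply: nji; rewrite e odirK.
rewrite (transport_other _ (nesym ji) nij).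
exact/fourthE/square_sym/frame_square.
Qed.

(** At the far vertex of the square, both frames have the corner [s.2 i] of the
    square in direction [odir j], hence its opposite in direction [j]. *)
Lemma transportC_axis i j k s : good_state s -> j <> i -> j <> odir i ->
  k = j \/ k = odir j ->
  (transport i (transport j s)).2 k = (transport j (transport i s)).2 k.
Proof.
move=> gs ji nji kE.
have ij : i <> j by move/esym.
have nij : i <> odir j by move=> e; apply: nji; rewrite e odirK.
have gj := transport_frame j gs.
have sq := frame_square gs ji nji; set z := fourth _ _ _ in sq.
have zE : (transport j s).2 i = z by exact: (transport_vertex gs ji nji).
have sqz : square (s.2 j) s.1 z (s.2 i) by exact/square_rot/square_sym.
have nk : k <> i /\ k <> odir i.
  by case: kE => ->; split=> //; [exact/neq_odir|exact: odir_neq_odir].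
rewrite transport_other; [|by case: nk|by case: nk].
rewrite zE; case: kE {nk} => ->.
  rewrite !transport_dir -[(transport i s).1]/(s.2 i).
  have -> : (transport i s).2 j = z by rewrite transport_other.
  apply/esym/antiE.
  apply: (opposite_transport LL) (square_sym sqz) _.
    by apply: antiP; have [FE _ _ _] := gs; rewrite adj_sym.
  by have := frame_square gj ji nji; rewrite zE transport_dir.
rewrite !transport_odir; apply: fourthE; exact: square_sym.
Qed.

(** Off the axes of [i] and [j] the two results are the far vertex of a cube. *)
Lemma transportC i j s : good_state s ->
  transport i (transport j s) = transport j (transport i s).
Proof.
apply: (@dir_case i j) => [->//|->|ji nji] gs.
  by rewrite transportK // -{1}[i]odirK transportK.
have ij : i <> j by move/esym.
have nij : i <> odir j by move=> e; apply: nji; rewrite e odirK.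
rewrite [LHS]surjective_pairing [RHS]surjective_pairing; congr pair.
  rewrite !transport_vertex //; apply: fourthE.
  exact/square_sym/frame_square.
apply/funext => k.
apply: (@dir_case j k) => [kj|kj|kj nkj]; try by apply: transportC_axis; auto.
apply: (@dir_case i k) => [ki|ki|ki nki];
  try by apply/esym/transportC_axis; auto.
rewrite !(transport_other _ ki nki) !(transport_other _ kj nkj).
rewrite !(transport_other _ ij nij) !(transport_other _ ji nji).
rewrite -![(transport _ s).1]/(s.2 _).
have [sij sik] := (frame_square gs ji nji, frame_square gs ki nki).
have sjk := frame_square gs kj nkj.
rewrite (fourthE (square_sym sij)).
have := frame_square (transport_frame i gs) kj nkj.
rewrite !(transport_other _ ki nki) !(transport_other _ ji nji).
rewrite -[(transport _ s).1]/(s.2 _) => sq.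
by apply: fourthE; exact: (cube_closes LL) sij sik sjk sq.
Qed.

Definition relabel (g : dir d -> dir d) s : state := (s.1, s.2 \o g).

Definition good_relabelling (g : dir d -> dir d) : Prop :=
  injective g /\ forall i, g (odir i) = odir (g i).

Lemma transport_relabel g i s : good_relabelling g ->
  transport i (relabel g s) = relabel g (transport (g i) s).
Proof.
move=> [gI go]; congr pair; apply/funext => j /=.
by rewrite -go !(inj_eq gI).
Qed.

Lemma frame_relabel v (F F' : dir d -> G) : frame v F -> frame v F' ->
  exists2 g, good_relabelling g & F' = F \o g.
Proof.
move=> fF [FE' FI' Fo' FS']; have [FE FI Fo FS] := fF.
have /choice[g gP] j : exists k, F' j = F k by exact: FS.
exists g; last exact/funext.
split=> [j k e|j]; first by apply: FI'; rewrite !gP e.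
by apply: (frame_opp fF); rewrite -!gP.
Qed.

Lemma ex_state_walk s : good_state s ->
  exists st : 'rV[int]_d -> state,
    [/\ st 0 = s, forall x, good_state (st x)
      & forall x a, st (x + uv a) = transport a (st x)].
Proof.
apply: lattice_walk; [exact: transport_frame|exact: transportK|exact: transportC].
Qed.

End Transport.

(** * Sublattices of finite exponent *)

Section Sublattice.
Variables (d : nat) (L : 'rV[int]_d -> Prop).
Hypothesis L0 : L 0.
Hypothesis LB : forall x y, L x -> L y -> L (x - y).

Lemma sublatticeN x : L x -> L (- x).
Proof. by move=> Lx; rewrite -[- x]add0r; exact: LB. Qed.

Lemma sublatticeD x y : L x -> L y -> L (x + y).
Proof. by move=> Lx Ly; rewrite -[y]opprK; apply: LB => //; exact: sublatticeN. Qed.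

Lemma sublatticeZ (z : int) x : L x -> L (z *: x).
Proof.
have LZ n : L x -> L (n%:Z *: x).
  move=> Lx; elim: n => [|n IHn]; first by rewrite scale0r.
  have -> : n.+1%:Z = n%:Z + 1 by rewrite -addn1 PoszD.
  by rewrite scalerDl scale1r; exact: sublatticeD.
case: z => n Lx; first exact: LZ.
by rewrite NegzE scaleNr; apply: sublatticeN; exact: LZ.
Qed.

Lemma sublattice_sum (I : finType) (F : I -> 'rV[int]_d) :
  (forall i, L (F i)) -> L (\sum_i F i).
Proof. by move=> LF; elim/big_ind: _ => // x y; exact: sublatticeD. Qed.

Variable k : nat.
Hypothesis k_gt0 : (0 < k)%N.
Hypothesis Lk : forall x, L (k%:Z *: x).

Let supp (n : nat) (x : 'rV[int]_d) := forall j : 'I_d, (n <= j)%N -> x 0 j = 0.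

(* A vector of the sublattice with least positive coordinate [i], among those
   supported on the first coordinates up to [i]. *)
Let ex_pivot (i : 'I_d) : exists h : 'rV[int]_d,
  [/\ L h, supp i.+1 h & forall x, L x -> supp i.+1 x ->
     exists q, supp i (x - q *: h)].
Proof.
pose A p := `[< (0 < p)%N /\ exists x, [/\ L x, supp i.+1 x & x 0 i = p%:Z] >].
have Ak : exists p, A p.
  exists k; apply/asboolP; split=> //; exists (k%:Z *: delta_mx 0 i).
  split=> // [j ij|]; rewrite !mxE ?eqxx ?mulr1 //.
  by case: eqVneq ij => [->|_]; rewrite ?ltnn // mulr0.
case: (ex_minnP Ak) => p /asboolP[p0 [h [Lh sh hi]]] pmin.
exists h; split=> // x Lx sx; exists (divz (x 0 i) p) => j.
have Lr : L (x - divz (x 0 i) p *: h) by apply: LB => //; exact: sublatticeZ.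
have sr : supp i.+1 (x - divz (x 0 i) p *: h).
  by move=> l il; rewrite !mxE (sx l il) (sh l il) mulr0 subrr.
rewrite leq_eqVlt => /orP[/eqP ij|]; last exact: sr.
have jE : j = i by apply: val_inj.
have ri : (x - divz (x 0 i) p *: h) 0 i = modz (x 0 i) p.
  by rewrite !mxE hi {1}(divz_eq (x 0 i) p%:Z) addrAC subrr add0r.
have pn0 : p%:Z != 0 by rewrite eqz_nat -lt0n.
rewrite jE ri; apply/eqP/negPn/negP => r0.
have m0 := modz_ge0 (x 0 i) pn0; have := ltz_mod (x 0 i) pn0.
have [l lE] : exists l : nat, modz (x 0 i) p = l%:Z.
  by exists (absz (modz (x 0 i) p)); rewrite gez0_abs.
rewrite lE in r0 ri * => lp; suff /pmin : A l.
  by rewrite leqNgt; move: lp; rewrite /= ltz_nat => ->.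
apply/asboolP; split; first by rewrite lt0n.
by exists (x - divz (x 0 i) p *: h).
Qed.

(** A triangular basis, obtained axis by axis by division with remainder. *)
Lemma sublattice_basis : exists h : 'I_d -> 'rV[int]_d,
  (forall i, L (h i)) /\
  forall x, L x -> exists a : 'I_d -> int, x = \sum_i a i *: h i.
Proof.
have /choice[h hP] := ex_pivot; exists h; split=> [i|x Lx]; first by case: (hP i).
have sx : supp d x by move=> j; rewrite leqNgt ltn_ord.
suff span n : (n <= d)%N -> forall x, L x -> supp n x ->
    exists a : 'I_d -> int, x = \sum_i a i *: h i by exact: span sx.
elim: n {x Lx sx} => [|n IHn] nd x Lx sx.
  exists (fun _ => 0); rewrite big1 => [|i _]; last by rewrite scale0r.
  by apply/rowP => j; rewrite mxE sx.
pose i := Ordinal nd; have [Lh sh hq] := hP i.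
have [q sq] := hq _ Lx sx.
have [|a aE] := IHn (ltnW nd) _ _ sq.
  by apply: LB => //; exact: sublatticeZ.
exists (fun j => a j + q *+ (j == i)).
under eq_bigr => j _ do rewrite scalerDl.
rewrite big_split /= -aE (bigD1 i) //= eqxx big1 ?addr0 ?subrK // => j ji.
by rewrite (negPf ji) scale0r.
Qed.

End Sublattice.

(** * Encoding the connected graphs that are locally a lattice *)

Section Codes.
Variable d : nat.

Definition relabelling : finType := {ffun dir d -> dir d}.

(** The linear map that permutes the directions according to [g]. *)
Definition dir_map (g : dir d -> dir d) (x : 'rV[int]_d) : 'rV[int]_d :=
  \sum_i x 0 i *: uv (g (i, true)).

Lemma dir_mapD g x y : dir_map g (x + y) = dir_map g x + dir_map g y.
Proof. by rewrite -big_split /=; apply: eq_bigr => i _; rewrite mxE scalerDl. Qed.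

Lemma dir_map_uv (g : dir d -> dir d) a :
  (forall i, g (odir i) = odir (g i)) -> dir_map g (uv a) = uv (g a).
Proof.
move=> go; rewrite /dir_map (bigD1 a.1) //= uvE eqxx big1 => [|i ia]; last first.
  by rewrite uvE eq_sym (negPf ia) scale0r.
rewrite addr0; case: a => i [] /=; first by rewrite scale1r.
by rewrite scaleN1r -uv_odir -go.
Qed.

Lemma dir_map0 g : dir_map g 0 = 0.
Proof. by rewrite /dir_map big1 // => i _; rewrite mxE scale0r. Qed.

Lemma dir_mapN g x : dir_map g (- x) = - dir_map g x.
Proof.
by apply: (addrI (dir_map g x)); rewrite -dir_mapD !subrr dir_map0.
Qed.

Lemma dir_map_id x : dir_map id x = x.
Proof.
rewrite /dir_map [RHS]row_sum_delta; apply: eq_bigr => i _.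
by rewrite /uv.
Qed.

(** A code consists of a modulus [k], of [d] vectors which together with [k Z^d]
    span a sublattice, and, for some of the relabellings [g], of a vector whose
    coset is the set of translations that go with [g]. *)
Definition code (K : nat) : finType :=
  ('I_K.+1 * {ffun 'I_d * 'I_d -> 'I_K.+1} *
   ({ffun relabelling * 'I_d -> 'I_K.+1} * {ffun relabelling -> bool}))%type.

Section Kernel.
Variables (K : nat) (c : code K).

Definition code_sublattice (z : 'rV[int]_d) : Prop :=
  exists (a : 'I_d -> int) (w : 'rV[int]_d),
    z = \sum_i a i *: (\row_j (c.1.2 (i, j) : nat)%:Z) + (c.1.1 : nat)%:Z *: w.

Definition code_kernel (x y : 'rV[int]_d) : Prop :=
  exists g : relabelling, [/\ good_relabelling g, c.2.2 g
    & code_sublattice (x - dir_map g y - \row_j (c.2.1 (g, j) : nat)%:Z)].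

End Kernel.

Lemma card_code K :
  #|code K| =
  (K.+1 * K.+1 ^ (d * d) * (K.+1 ^ (#|relabelling| * d) * 2 ^ #|relabelling|))%N.
Proof.
have rE : #|relabelling| = ((d * 2) ^ (d * 2))%N.
  by rewrite card_ffun !card_prod card_ord card_bool.
by rewrite !card_prod !card_ffun !card_prod !card_ord card_bool !rE.
Qed.

(** [G] is the quotient of the lattice by the equivalence relation that [c]
    describes. *)
Definition coded (G : sgraph) (K : nat) (c : code K) : Prop :=
  exists P : 'rV[int]_d -> G,
    [/\ forall v, exists x, v = P x,
        forall x w, adj (P x) w <-> exists a, w = P (x + uv a)
      & forall x y, P x = P y <-> code_kernel c x y].

(** The kernel determines the vertices, and adjacency is the image of that of the
    lattice. *)
Lemma coded_isomorphic (G H : sgraph) (K : nat) (c : code K) :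
  coded G c -> coded H c -> isomorphic G H.
Proof.
move=> [P [PS PE PK]] [Q [QS QE QK]].
pose R v w := exists2 x, v = P x & w = Q x.
have PQ x y : P x = P y <-> Q x = Q y by split=> [/PK/QK|/QK/PK].
apply: (@isomorphic_of_rel _ _ R).
- by move=> v; have [x ->] := PS v; exists (Q x), x.
- by move=> v; have [x ->] := QS v; exists (P x), x.
- by move=> v w v' w' [x -> ->] [y -> ->].
move=> v w v' w' [x -> ->] [y -> ->].
by apply/idP/idP => [/PE|/QE] [a e]; [apply/QE|apply/PE]; exists a; apply/PQ.
Qed.

Definition has_order (n : nat) (G : sgraph) : Prop :=
  exists f : 'I_n -> G, bijective f.

Definition code_bound (m : nat) : nat := ((m * m ^ #|{: dir d}|) ^ d)%N.

Section Encoding.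
Variables (m : nat) (G : sgraph).
Hypotheses (LL : lattice_like d G) (conG : connected G) (ordG : has_order m G).
Variable st : 'rV[int]_d -> state d G.
Hypothesis stF : forall x, good_state (st x).
Hypothesis stE : forall x a, st (x + uv a) = transport LL a (st x).

Let P x := (st x).1.

Let stD g x y w : good_relabelling g -> st y = relabel g (st x) ->
  st (y + w) = relabel g (st (x + dir_map g w)).
Proof.
move=> gg e; elim/lattice_ind: w => [|w a IHw]; first by rewrite dir_map0 !addr0.
rewrite addrA stE IHw transport_relabel // -stE dir_mapD dir_map_uv //.
  by rewrite addrA.
by case: gg.
Qed.

Let good_id : good_relabelling (@id (dir d)).
Proof. by split. Qed.

Let relabel_id s : relabel id s = s :> state d G.
Proof. by case: s. Qed.

Let stD1 x y w : st y = st x -> st (y + w) = st (x + w).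
Proof.
move=> e; rewrite (stD w good_id (_ : _ = relabel id (st x))) ?relabel_id //.
by rewrite dir_map_id.
Qed.

Let L z := st z = st 0.

Let LB x y : L x -> L y -> L (x - y).
Proof.
rewrite /L => Lx Ly; rewrite (stD1 (- y) Lx) add0r.
by have := stD1 (- y) Ly; rewrite subrr add0r => <-.
Qed.

Let coset (g : dir d -> dir d) z := relabel g (st z) = st 0.

(* Frames over the same vertex differ by a relabelling [g]; walking back from [y]
   to the origin turns this into a condition at one point. *)
Let P_eq x y : P x = P y <->
  exists2 g : relabelling, good_relabelling g & coset g (x - dir_map g y).
Proof.
split=> [xy|[g gg cg]].
  have fy : frame (st x).1 (st y).2 by rewrite -/(P x) xy; exact: stF.
  have [g gg e] := frame_relabel LL (stF x) fy.
  have gf : [ffun i => g i] = g :> (_ -> _) by apply/funext => i; rewrite ffunE.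
  exists [ffun i => g i]; rewrite gf // /coset -dir_mapN.
  rewrite -(stD (- y) gg (y := y)) ?subrr //.
  by rewrite [st y]surjective_pairing e; congr pair.
have := stD y gg (esym cg); rewrite subrK add0r /P => ->.
by [].
Qed.

Let coset_sub g z z' : good_relabelling g -> coset g z -> coset g z' -> L (z' - z).
Proof.
rewrite /coset => gg e e'; suff zz : st z' = st z.
  by rewrite /L -(subrr z); exact: stD1.
have [h _ hK] := injF_bij gg.1.
rewrite -e' in e; case: e => e1 e2.
rewrite [LHS]surjective_pairing [RHS]surjective_pairing e1; congr pair.
apply/funext => i; have := congr1 (fun F => F (h i)) e2.
by rewrite /= hK.
Qed.

Let coset_add g z x : coset g z -> L x -> coset g (z + x).
Proof.
by rewrite /coset /L => zg Lx; rewrite addrC (stD1 z Lx) add0r.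
Qed.

(* There are at most [m * m ^ (2 d)] states, so some multiple of each basis vector
   returns to the same state. *)
Let ex_period i : exists k, [/\ (0 < k)%N, (k <= m * m ^ #|{: dir d}|)%N
  & L (k%:Z *: uv (i, true))].
Proof.
have [f [h fK hK]] := ordG; set M := (m * _)%N.
pose fs (s : state d G) : 'I_m * {ffun dir d -> 'I_m} :=
  (h s.1, [ffun i => h (s.2 i)]).
have fsI s t : fs s = fs t -> s = t.
  move=> [e1 /ffunP e2]; rewrite [s]surjective_pairing [t]surjective_pairing.
  congr pair; first exact: can_inj hK _ _ e1.
  by apply/funext => j; have := e2 j; rewrite !ffunE; exact: can_inj.
pose F (j : 'I_M.+1) := fs (st ((j : nat)%:Z *: uv (i, true))).
have /injectiveP : ~ injective F.
  move=> /leq_card; rewrite card_prod card_ffun !card_ord /M.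
  by rewrite ltnn.
case/injectivePn => j [j' jj' /fsI].
wlog lt : j j' jj' / (j < j')%N.
  move=> W; have [] := ltngtP j j'; first exact: W.
    by move=> + /esym; apply: W; rewrite eq_sym.
  by move/val_inj => e; rewrite e eqxx in jj'.
move=> e; exists (j' - j)%N; split.
- by rewrite subn_gt0.
- by rewrite (leq_trans (leq_subr _ _)) // -ltnS.
rewrite /L -(subrr ((j : nat)%:Z *: uv (i, true))) -subzn ?(ltnW lt) //.
by rewrite scalerBl; apply: stD1.
Qed.

(** Since [k Z^d] consists of periods, replacing generators and coset
    representatives by their residues modulo [k] loses nothing. *)
Lemma ex_code : exists c : code (code_bound m), coded G c.
Proof.
have /choice[ki kiP] := ex_period; pose k := (\prod_i ki i)%N.
have L0 : L 0 by [].
have k0 : (0 < k)%N by apply: prodn_gt0 => i; case: (kiP i).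
have kK : (k < (code_bound m).+1)%N.
  have -> : code_bound m = (\prod_(i < d) (m * m ^ #|{: dir d}|))%N.
    by rewrite prod_nat_const card_ord.
  rewrite ltnS /k.
  by apply: leq_prod => i _; case: (kiP i).
have Lk x : L (k%:Z *: x).
  rewrite [x]row_sum_delta scaler_sumr; apply: sublattice_sum => // i.
  rewrite scalerA mulrC -scalerA; apply: sublatticeZ => //.
  rewrite /k (bigD1 i) //= mulnC PoszM -scalerA; apply: sublatticeZ => //.
  by case: (kiP i).
have [h [Lh hS]] := sublattice_basis L0 LB k0 Lk.
have kn0 : k%:Z != 0 by rewrite eqz_nat -lt0n.
have resK (z : int) : (absz (modz z k) < (code_bound m).+1)%N.
  by apply: ltn_trans kK; rewrite -ltz_nat gez0_abs ?modz_ge0 //; exact: ltz_mod.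
pose res z : 'I_(code_bound m).+1 := Ordinal (resK z).
have resE z : z = (res z : nat)%:Z + k%:Z * divz z k.
  by rewrite /= gez0_abs ?modz_ge0 // {1}(divz_eq z k%:Z) addrC mulrC.
pose resv (x : 'rV[int]_d) : 'rV[int]_d := \row_j (res (x 0 j) : nat)%:Z.
have resvE x : exists y, x = resv x + k%:Z *: y.
  exists (\row_j divz (x 0 j) k); apply/rowP => j; rewrite !mxE.
  exact: resE.
have /choice[rep repP] (g : relabelling) :
    exists z, (exists z', coset g z') -> coset g z.
  by have [[z zg]|nz] := pselect (exists z', coset g z'); [exists z|exists 0 => /nz].
have rep_res (g : relabelling) : (exists z, coset g z) -> coset g (resv (rep g)).
  move=> /repP; have [y yE] := resvE (rep g).
  move=> /coset_add/(_ (sublatticeN L0 LB (Lk y))).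
  by rewrite {1}yE addrK.
pose c : code (code_bound m) :=
  ((Ordinal kK, [ffun p => res (h p.1 0 p.2)]),
   ([ffun p => res (rep p.1 0 p.2)], [ffun g : relabelling => `[< exists z, coset g z >]])).
have cL z : code_sublattice c z <-> L z.
  have rowE i : \row_j (c.1.2 (i, j) : nat)%:Z = resv (h i).
    by apply/rowP => j; rewrite !mxE ffunE.
  split=> [[a [w ->]]|/hS[a ->]].
    apply: (sublatticeD L0 LB _ (Lk w)).
    apply: (sublattice_sum L0 LB) => i; apply: (sublatticeZ L0 LB).
    rewrite rowE; have [y yE] := resvE (h i).
    have -> : resv (h i) = h i - k%:Z *: y by rewrite {2}yE addrK.
    exact: LB.
  have /choice[y yE] i := resvE (h i).
  exists a, (\sum_i a i *: y i); rewrite scaler_sumr -big_split /=.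
  apply: eq_bigr => i _; rewrite rowE {1}(yE i) scalerDr; congr (_ + _).
  by rewrite !scalerA mulrC.
have cosetE (g : relabelling) z : good_relabelling g ->
    coset g z <-> c.2.2 g /\ code_sublattice c (z - \row_j (c.2.1 (g, j) : nat)%:Z).
  move=> gg; have -> : \row_j (c.2.1 (g, j) : nat)%:Z = resv (rep g).
    by apply/rowP => j; rewrite !mxE ffunE.
  rewrite cL ffunE; split=> [zg|[/asboolP/rep_res zg Lz]].
    have gz : exists z', coset g z' by exists z.
    by split; [exact/asboolP|apply: coset_sub zg => //; exact: rep_res].
  by have := coset_add zg Lz; rewrite addrC subrK.
have [F0 _ _ _] := stF 0.
exists c, P; split=> [v|x w|x y].
- apply: (conG (S := fun v => exists x, v = P x)) (ex_intro _ 0 erefl).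
  move=> u w uw [x ux]; rewrite ux in uw.
  have [_ _ _ FS] := stF x; have [a ->] := FS _ uw.
  by exists (x + uv a); rewrite /P stE.
- have [FE _ _ FS] := stF x; split=> [/FS[a ->]|[a ->]].
    by exists a; rewrite /P stE.
  by rewrite /P stE; exact: FE.
- split=> [/P_eq[g gg /(cosetE _ _ gg)[]]|[g [gg cg cs]]]; first by exists g.
  by apply/P_eq; exists g => //; apply/(cosetE _ _ gg); split.
Qed.

End Encoding.
End Codes.

Lemma ex_coded (d m : nat) (G : sgraph) :
  lattice_like d G -> connected G -> has_order m G -> (0 < m)%N ->
  exists c : code d (code_bound d m), coded G c.
Proof.
move=> LL conG ordG m0; have [f _] := ordG.
have [F fF] := ex_frame LL (f (Ordinal m0)).
have [st [_ stF stE]] := @ex_state_walk d G LL (f (Ordinal m0), F) fF.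
exact: (@ex_code d m G LL conG ordG st stF stE).
Qed.

Lemma card_code_le (d : nat) : exists C : nat, forall m n : nat,
  (0 < m <= n)%N -> (#|code d (code_bound d m)| <= n.+1 ^ C)%N.
Proof.
pose e := ((#|{: dir d}|).+1 * d)%N; pose R := #|relabelling d|.
exists (e.+1 + e.+1 * (d * d) + (e.+1 * (R * d) + R))%N => m n /andP[m0 mn].
have le : ((code_bound d m).+1 <= n.+1 ^ e.+1)%N.
  rewrite /code_bound -expnS -expnM -/e.
  apply: (@leq_trans (m.+1 ^ e.+1)); last by rewrite leq_exp2r.
  have me : (m ^ e <= m.+1 ^ e)%N by case: (e) => // e'; rewrite leq_exp2r.
  rewrite expnS mulSn -addn1; apply: leq_add => //.
  by rewrite muln_gt0 m0 expn_gt0.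
have leX p : ((code_bound d m).+1 ^ p <= n.+1 ^ (e.+1 * p))%N.
  by case: p => [|p]; rewrite ?muln0 // expnM leq_exp2r.
rewrite card_code (expnD _ (_ + _)%N (_ + _)%N) (expnD _ e.+1) (expnD _ (e.+1 * _)%N).
apply: leq_mul; apply: leq_mul; rewrite -/R; try exact: leX.
  exact: le.
by case: (R) => // p; rewrite leq_exp2r //; lia.
Qed.

(** * Circulant graphs that are locally a lattice *)

Section BaseExpansion.
Variables (s : nat) (f : nat -> int).
Hypothesis fs : forall i, `|f i| < s%:Z.

Let digits n : int := \sum_(i < n) (s ^ i)%:Z * f i.

(** Base [s] expansions with signed digits are unique, since the part below a
    given place is smaller than one unit there. *)
Lemma digits_lt n : `|digits n| < (s ^ n)%:Z.
Proof.
elim: n => [|n IHn]; first by rewrite /digits big_ord0 normr0.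
rewrite /digits big_ord_recr /= -/(digits n) expnS.
have le : `|f n| <= s%:Z - 1 by have := fs n; lia.
have := ler_normD (digits n) ((s ^ n)%:Z * f n).
rewrite normrM (ger0_norm (ltac:(lia) : 0 <= (s ^ n)%:Z)).
have : 0 <= (s ^ n)%:Z by lia.
move: le IHn; rewrite PoszM; nia.
Qed.

Lemma digits_eq0 n : digits n = 0 -> forall i, (i < n)%N -> f i = 0.
Proof.
elim: n => // n IHn; rewrite /digits big_ord_recr /= -/(digits n) => e.
have fn : f n = 0.
  apply/eqP/negPn/negP => fn0; have := digits_lt n.
  have -> : digits n = - ((s ^ n)%:Z * f n) by apply/eqP; rewrite -addr_eq0 e.
  rewrite normrN normrM (ger0_norm (ltac:(lia) : 0 <= (s ^ n)%:Z)).
  have : 1 <= `|f n| by rewrite -gtz0_ge1 normr_gt0.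
  have : 0 <= (s ^ n)%:Z by lia.
  by nia.
move=> i; rewrite ltnS leq_eqVlt => /orP[/eqP->//|]; apply: IHn.
by move: e; rewrite fn mulr0 addr0.
Qed.

End BaseExpansion.

Section Circulant.
Variables (d s n : nat).

(** The condition [x != y] makes this a simple graph for all parameters. *)
Definition circ_adj : rel 'I_n.+1 := fun x y =>
  (x != y) &&
  [exists i : 'I_d, (y == x + Zp1 *+ (s ^ i)) || (x == y + Zp1 *+ (s ^ i))].

Fact circ_adj_sym : symmetric circ_adj.
Proof.
by move=> x y; rewrite /circ_adj eq_sym; congr andb; apply: eq_existsb => i; rewrite orbC.
Qed.

Fact circ_adj_irr : irreflexive circ_adj.
Proof. by move=> x; rewrite /circ_adj eqxx. Qed.

Definition circulant : sgraph := SGraph circ_adj_sym circ_adj_irr.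

Lemma circulant_connected : (0 < d)%N -> connected circulant.
Proof.
move=> d0 S Scl x y Sx.
have step z : S z -> S (z + Zp1).
  have [<-//|zz] := eqVneq z (z + Zp1); apply: Scl; apply/andP; split=> //.
  by apply/existsP; exists (Ordinal d0); rewrite expn0 eqxx.
have steps m : S (x + Zp1 *+ m).
  by elim: m => [|m IHm]; rewrite ?addr0 // mulrSr addrA; exact: step.
pose t : 'I_n.+1 := (y : 'I_n.+1) - (x : 'I_n.+1).
have tE : Zp1 *+ val t = t.
  by rewrite Zp_mulrn; apply: val_inj; rewrite /= modnMml mul1n modn_mod.
by have := steps (val t); rewrite tE /t addrC subrK.
Qed.

Let enc (x : 'rV[int]_d) : int := \sum_(i < d) (s ^ i)%:Z * x 0 i.

Let encD x y : enc (x + y) = enc x + enc y.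
Proof. by rewrite -big_split /=; apply: eq_bigr => i _; rewrite mxE mulrDr. Qed.

Let encN x : enc (- x) = - enc x.
Proof. by rewrite -sumrN; apply: eq_bigr => i _; rewrite mxE mulrN. Qed.

Let enc_uv (a : dir d) : enc (uv a) = if a.2 then (s ^ a.1)%:Z else - (s ^ a.1)%:Z.
Proof.
rewrite /enc (bigD1 a.1) //= uvE eqxx big1 ?addr0 => [|i ia]; last first.
  by rewrite uvE eq_sym (negPf ia) mulr0.
by case: a.2; rewrite ?mulr1 ?mulrN1.
Qed.

Let cmap (v : 'I_n.+1) (x : 'rV[int]_d) : 'I_n.+1 := v + Zp1 *~ enc x.

Let cmap_uv v x a : cmap v (x + uv a) =
  if a.2 then cmap v x + Zp1 *+ (s ^ a.1) else cmap v x - Zp1 *+ (s ^ a.1).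
Proof. by rewrite /cmap encD enc_uv; case: a.2; rewrite ?mulrzDr addrA // mulrNz. Qed.

Hypothesis s_gt1 : (1 < s)%N.
Hypothesis n_large : (s ^ d <= n.+1)%N.

(* A lattice vector with small coordinates that is sent to 0 is 0: [enc x] is
   smaller than [n.+1] in absolute value, hence vanishes as an integer. *)
Let enc_inj (x : 'rV[int]_d) : (forall i, `|x 0 i| < s%:Z) ->
  Zp1 *~ enc x = 0 :> 'I_n.+1 -> x = 0.
Proof.
move=> xs e.
pose f i := if insub i is Some j then x 0 j else 0.
have fE (i : 'I_d) : f i = x 0 i by rewrite /f valK.
have fs i : `|f i| < s%:Z by rewrite /f; case: insub => // ; lia.
have encE : enc x = \sum_(i < d) (s ^ i)%:Z * f i.
  by apply: eq_bigr => i _; rewrite fE.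
have small : `|enc x| < n.+1%:Z.
  by apply: lt_le_trans (_ : (s ^ d)%:Z <= _) => //; rewrite encE; exact: digits_lt.
have Zp0n m : Zp1 *+ m = 0 :> 'I_n.+1 -> (n.+1 %| m)%N.
  by rewrite Zp_mulrn => /(congr1 val) /=; rewrite modnMml mul1n => /eqP.
have enc0 : enc x = 0.
  move: e small; case: (enc x) => m e; rewrite ?NegzE ?normrN ltz_nat => small.
    by move/Zp0n: e => /dvdn_leq; case: m small => // m; lia.
  move/eqP: e; rewrite NegzE mulrNz oppr_eq0 => /eqP/Zp0n/dvdn_leq; lia.
apply/rowP => i; rewrite mxE -fE.
by apply: (digits_eq0 fs (n := d)); rewrite // -encE.
Qed.

Let adj_cmap v x a : circ_adj (cmap v x) (cmap v (x + uv a)).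
Proof.
apply/andP; split.
  apply/eqP; rewrite /cmap encD mulrzDr addrA => /esym/eqP.
  rewrite -subr_eq0 [_ + Zp1 *~ enc (uv a)]addrC addrK => /eqP/enc_inj e.
  have := odir_neq (esym (uvD_eq0 (b := a) (a := a) _)); apply.
  by rewrite e ?addr0 // => i; rewrite uvE; case: ifP => _; [case: a.2|]; lia.
apply/existsP; exists a.1; rewrite cmap_uv.
by case: a.2; rewrite ?subrK eqxx ?orbT.
Qed.

Let cmap_lift v x w : circ_adj (cmap v x) w ->
  exists2 y, @adj (lattice d) x y & cmap v y = w.
Proof.
move=> /andP[_ /existsP[i /orP[/eqP->|/eqP e]]].
  by exists (x + uv (i, true)); [exact: adj_uv|rewrite cmap_uv].
by exists (x + uv (i, false)); [exact: adj_uv|rewrite cmap_uv e /= addrK].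
Qed.

Let ball_coord r (x : lattice d) : gball r (0 : lattice d) x -> forall i, `|x 0 i| <= r%:Z.
Proof.
elim: r x => [|r IHr] x; first by move/gball0-> => i; rewrite mxE.
move/gballS=> [->|[y /IHr yr /lattice_adjP[a ->]]] i; first by rewrite mxE.
have step (z t : int) : `|z| <= r%:Z -> `|t| <= 1 -> `|z + t| <= r.+1%:Z by lia.
rewrite mxE; apply: step (yr i) _; rewrite uvE.
by case: ifP => // _; case: a.2.
Qed.

(** The map [x |-> v + enc x] is a homomorphism that lifts edges. Points of the
    ball of radius [r] differ by at most [2 r] in each coordinate, and by at most
    [2 r + 1] after one more step, so on this ball both equality and adjacency
    are reflected. *)
Lemma circulant_local (r : nat) : (2 * r + 1 < s)%N ->
  locally (0 : lattice d) r circulant.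
Proof.
move=> rs; apply/locally_chart => v; exists (cmap v); split.
- by rewrite /cmap /enc big1 ?addr0 // => i _; rewrite mxE mulr0.
- move=> x y /ball_coord xr /ball_coord yr /addrI e.
  apply/eqP; rewrite -subr_eq0; apply/eqP/enc_inj => [i|].
    have step (p q : int) : `|p| <= r%:Z -> `|q| <= r%:Z -> `|p - q| < s%:Z by lia.
    by rewrite !mxE; exact: step.
  by rewrite encD encN mulrzBr e subrr.
- move=> x y /ball_coord xr /ball_coord yr; apply/idP/idP; last first.
    by move/lattice_adjP=> [a ->]; exact: adj_cmap.
  move/cmap_lift=> [z /lattice_adjP[a ->]] /addrI e; apply/lattice_adjP; exists a.
  apply/eqP; rewrite -subr_eq0; apply/eqP/enc_inj => [i|].
    have step (p q t : int) : `|p| <= r%:Z -> `|q| <= r%:Z -> `|t| <= 1 ->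
      `|p - (q + t)| < s%:Z by lia.
    rewrite !mxE; apply: step => //; rewrite uvE.
    by case: ifP => // _; case: a.2.
  by rewrite encD encN mulrzBr e subrr.
- have v0 : cmap v 0 = v by rewrite /cmap /enc big1 ?addr0 // => i _; rewrite mxE mulr0.
  move=> w; rewrite -{1}v0; apply: (@gball_image (lattice d) circulant).
    by move=> x y /lattice_adjP[a ->]; exact: adj_cmap.
  exact: cmap_lift.
Qed.

Lemma circulant_order : has_order n.+1 circulant.
Proof. by exists id; exists id. Qed.

End Circulant.

(** * Unlabelled graphs and their components *)

Lemma has_order_gsum m n (G H : sgraph) :
  has_order m G -> has_order n H -> has_order (m + n) (gsum G H).
Proof.
move=> [f [f' fK f'K]] [g [g' gK g'K]].
exists (fun i => match split i with inl a => inl (f a) | inr b => inr (g b) end).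
exists (fun x => unsplit (match x with inl a => inl (f' a) | inr b => inr (g' b) end)).
- move=> i; rewrite -[RHS]splitK; congr unsplit.
  by case: (split i) => a; rewrite ?fK ?gK.
- by case=> x; rewrite unsplitK ?f'K ?g'K.
Qed.

Lemma has_order_inj n (G : sgraph) (f : G -> G) :
  has_order n G -> injective f -> bijective f.
Proof.
move=> [g [h gK hK]] fI.
have [k fK kK] : bijective (h \o f \o g).
  by apply: injF_bij => x y /(can_inj hK)/fI/(can_inj gK).
exists (g \o k \o h) => x /=.
  by have := fK (h x); rewrite /= hK => ->.
by have := kK (h x); rewrite /= => /(can_inj hK).
Qed.

Lemma has_order_finType (T : finType) (e : rel T) (es : symmetric e)
  (ei : irreflexive e) : has_order #|T| (SGraph es ei).
Proof. by exists enum_val; exact: enum_val_bij. Qed.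

Lemma ex_ugraph n (G : sgraph) :
  has_order n G -> exists g : ugraph n, isomorphic (ugraph_sgraph g) G.
Proof.
move=> [f fb].
pose E := [set [set p.1; p.2] | p in [set p : 'I_n * 'I_n | adj (f p.1) (f p.2)]].
have EP : [forall e in E, #|e| == 2%N].
  apply/forall_inP => _ /imsetP[[x y] + ->]; rewrite inE /= cards2.
  by case: (eqVneq x y) => // ->; rewrite adj_irr.
pose L : lgraph n := exist _ E EP.
have LG : isomorphic (sgraph_of L) G.
  exists f; split=> // x y; apply/idP/imsetP => [xy|[[x' y']]].
    by exists (x, y); rewrite ?inE.
  rewrite inE /= => xy' e.
  have := set21 x y; have := set22 x y; have := set21 x' y'; have := set22 x' y'.
  rewrite e -{1 2}e !inE.
  by do 4![case/orP => /eqP ?]; subst; rewrite // adj_sym.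
exists (\pi_(ugraph n)%qT L); apply: isomorphic_trans _ LG.
by have /eqmodP/asboolP : (repr (\pi_(ugraph n)%qT L) = L %[mod ugraph n])%qT by rewrite reprK.
Qed.

Lemma ugraph_isomorphic n (g h : ugraph n) :
  isomorphic (ugraph_sgraph g) (ugraph_sgraph h) -> g = h.
Proof.
by move=> gh; rewrite -[g]reprK -[h]reprK; apply/eqmodP/asboolP.
Qed.

Section Subgraph.
Variables (G : sgraph) (P : pred G).

Definition sub_adj : rel {x : G | P x} := fun x y => adj (val x) (val y).
Fact sub_adj_sym : symmetric sub_adj.
Proof. by move=> x y; rewrite /sub_adj adj_sym. Qed.
Fact sub_adj_irr : irreflexive sub_adj.
Proof. by move=> x; rewrite /sub_adj adj_irr. Qed.
Definition subgraph := SGraph sub_adj_sym sub_adj_irr.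
End Subgraph.

Lemma split_isomorphic (G : sgraph) (P : pred G) :
  (forall x y, adj x y -> P x = P y) ->
  isomorphic G (gsum (subgraph (predC P)) (subgraph P)).
Proof.
move=> Pcl; pose R (x : G) (y : gsum (subgraph (predC P)) (subgraph P)) :=
  match y with inl a => val a = x | inr a => val a = x end.
apply: (@isomorphic_of_rel _ _ R).
- move=> x; have [Px|nPx] := boolP (P x).
    by exists (inr (exist _ x Px)).
  by exists (inl (exist _ x nPx)).
- by case=> y; exists (val y).
- move=> x [] [y yP] x' [] [y' y'P] /= <- <-; split=> [e|[] e] //.
  + by congr inl; exact: val_inj.
  + by case/negP: (yP); rewrite e.
  + by case/negP: (y'P); rewrite -e.
  + by congr inr; exact: val_inj.
- move=> x [] [y yP] x' [] [y' y'P] /= <- <- //.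
    by apply/negbTE/negP => /Pcl e; case/negP: (yP); rewrite e.
  by apply/negbTE/negP => /Pcl e; case/negP: (y'P); rewrite -e.
Qed.

Section Components.
Variables (n : nat) (E : lgraph n).

Let conn_sym : connect_sym (lgraph_adj E).
Proof. exact/sym_connect_sym/lgraph_adj_sym. Qed.

Lemma componentsP (C : {set 'I_n}) :
  reflect (exists x, C = [set y | connect (lgraph_adj E) x y]) (C \in components E).
Proof.
apply: (iffP imsetP) => [[x _ ->]|[x ->]]; exists x => //.
  by apply/setP => y; rewrite !inE.
by apply/setP => y; rewrite !inE.
Qed.

Lemma split_component (C : {set 'I_n}) : C \in components E ->
  exists H K : sgraph, [/\ connected K, has_order #|C| K,
    has_order (n - #|C|) H, (0 < #|C|)%N & isomorphic (sgraph_of E) (gsum H K)].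
Proof.
move=> /componentsP[x CE].
have Ccl y z : lgraph_adj E y z -> (y \in C) = (z \in C).
  by move=> yz; rewrite CE !inE; apply: same_connect_r => //; exact: connect1.
exists (@subgraph (sgraph_of E) (predC (mem C))), (@subgraph (sgraph_of E) (mem C)).
split.
- move=> S Scl [y yC] [z zC] Sy.
  have : connect (lgraph_adj E) y z.
    move: (yC) (zC); rewrite /= CE !inE conn_sym => yx xz.
    exact: connect_trans yx xz.
  case/connectP => p; elim: p y yC Sy => [|w p IHp] y yC Sy /=.
    move=> _ zy; rewrite (_ : exist _ z zC = exist _ y yC) //; exact: val_inj.
  case/andP=> yw wp zE; have wC : w \in C by rewrite -(Ccl _ _ yw).
  by apply: (IHp w wC) => //; apply: Scl Sy; exact: yw.
- have := has_order_finType (@sub_adj_sym (sgraph_of E) (mem C))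
    (@sub_adj_irr (sgraph_of E) (mem C)).
  by rewrite card_sig.
- have := has_order_finType (@sub_adj_sym (sgraph_of E) (predC (mem C)))
    (@sub_adj_irr (sgraph_of E) (predC (mem C))).
  rewrite card_sig; have <- : #|[predC C]| = (n - #|C|)%N.
    by rewrite -(addKn #|C| #|[predC C]|) cardC card_ord.
  by [].
- by apply/card_gt0P; exists x; rewrite CE inE.
- exact: split_isomorphic.
Qed.

(** The image of [j] is a component. *)
Lemma component_of_embedding (K : sgraph) (a : nat) (j : K -> sgraph_of E) :
  connected K -> has_order a K -> (0 < a)%N -> closed_embedding j ->
  exists2 C, C \in components E & #|C| = a.
Proof.
move=> conK [f [f' fK f'K]] a0 [jI jE jcl].
pose C := [set y | connect (lgraph_adj E) (j (f (Ordinal a0))) y].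
exists C; first by apply/componentsP; eexists.
have -> : C = [set j (f i) | i : 'I_a].
  apply/setP => y; rewrite inE; apply/idP/imsetP => [|[i _ ->]].
    case/connectP => p; elim: p (Ordinal a0) => [|w p IHp] i /=.
      by move=> _ ->; exists i.
    case/andP=> iw wp yE; have [k wk] := jcl _ _ iw.
    by move: wp yE; rewrite wk -[k]f'K; exact: IHp.
  apply: (conK (fun k => connect (lgraph_adj E) (j (f (Ordinal a0))) (j k))
     _ (f (Ordinal a0))) => // k l kl.
  move/connect_trans; apply; apply: connect1.
  by rewrite -[lgraph_adj _ _ _]/(adj (j k) (j l)) jE.
by rewrite card_imset ?card_ord // => i k /jI /(can_inj fK).
Qed.

Definition component_orders : seq nat :=
  undup [seq #|C : {set 'I_n}| | C <- enum (components E)].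

Lemma mem_component_orders a :
  reflect (exists2 C, C \in components E & #|C| = a) (a \in component_orders).
Proof.
rewrite mem_undup; apply: (iffP mapP) => -[C CE e]; exists C => //.
  by rewrite mem_enum in CE.
by rewrite mem_enum.
Qed.

Lemma sum_component_orders : (sumn component_orders <= n)%N.
Proof.
have sumn_undup s : (sumn (undup s) <= sumn s)%N.
  elim: s => //= x s IHs; case: ifP => _ /=; last by rewrite leq_add2l.
  exact: leq_trans IHs (leq_addl _ _).
apply: leq_trans (sumn_undup _) _; rewrite sumnE big_map big_enum /=.
have pC : finset.partition (components E) [set: 'I_n].
  apply: finset.equivalence_partitionP => x y z _ _ _; split; first exact: connect0.
  by move=> xy; exact: same_connect.
by rewrite -(finset.card_partition pC) cardsT card_ord.
Qed.

End Components.

Lemma uniq_sumn (s : seq nat) :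
  uniq s -> 0%N \notin s -> (size s * (size s).+1 <= 2 * sumn s)%N.
Proof.
have [N] : exists N, forall x, x \in s -> (x <= N)%N.
  exists (sumn s) => x; elim: s => //= y s IHs; rewrite inE.
  by case/orP=> [/eqP->|/IHs xs]; [exact: leq_addr|exact: leq_trans xs (leq_addl _ _)].
elim: N s => [|N IHN] s sN us s0.
  case: s sN s0 {us} => // x s /(_ x (mem_head _ _)); rewrite leqn0 => /eqP->.
  by rewrite inE.
have [Ns|Ns] := boolP (N.+1 \in s); last first.
  apply: IHN => // x xs; have := sN x xs; rewrite leq_eqVlt => /orP[/eqP xN|//].
  by rewrite -xN xs in Ns.
have ps := perm_to_rem Ns; set s' := rem _ _ in ps.
have us' : uniq s' by exact: rem_uniq.
have ss' : {subset s' <= s} by exact: mem_rem.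
have := IHN s' _ us' (contra (@ss' _) s0); rewrite (perm_size ps) (perm_sumn ps) /=.
have sz : (size s' <= N)%N.
  rewrite -(size_iota 1 N); apply: uniq_leq_size => // x xs; rewrite mem_iota.
  have := sN _ (ss' _ xs); rewrite leq_eqVlt => /orP[/eqP xN|].
    by move: xs; rewrite xN mem_rem_uniq // inE eqxx.
  case: x xs => // /ss'; by rewrite (negPf s0).
move=> IH; suff : (size s' * (size s').+1 <= 2 * sumn s')%N.
  by clear -sz; move: (size s') (sumn s') sz => a b ab; nia.
apply: IH => x xs; have := sN _ (ss' _ xs); rewrite leq_eqVlt => /orP[/eqP xN|//].
by move: xs; rewrite xN mem_rem_uniq // inE eqxx.
Qed.

Lemma size_component_orders n (E : lgraph n) :
  (size (component_orders E) ^ 2 <= 2 * n)%N.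
Proof.
have := uniq_sumn (undup_uniq _ : uniq (component_orders E)).
have s0 : 0%N \notin component_orders E.
  apply/negP => /mem_component_orders[C /split_component[H [K [_ _ _ C0 _]]] e].
  by rewrite e in C0.
move=> /(_ s0) h; have := sum_component_orders E; lia.
Qed.

(** * Comparing numbers of graphs *)

Lemma leq_card_rel (A B : finType) (X : {set A}) (Y : {set B}) (R : A -> B -> Prop) :
  (forall a, a \in X -> exists2 b, b \in Y & R a b) ->
  (forall a a' b, a \in X -> a' \in X -> R a b -> R a' b -> a = a') ->
  (#|X| <= #|Y|)%N.
Proof.
move=> tot inj.
have /choice[f fP] (a : {a | a \in X}) : exists b, b \in Y /\ R (val a) b.
  by have [b bY Rab] := tot _ (valP a); exists b.
have fI : injective f.
  move=> a b e; apply: val_inj; apply: inj (valP a) (valP b) (fP a).2 _.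
  by rewrite e; exact: (fP b).2.
rewrite -(card_sig (mem X)) -cardsT -(card_imset _ fI).
by apply/subset_leq_card/fintype.subsetP => _ /imsetP[a _ ->]; have [] := fP a.
Qed.

Section Counting.
Variables d r : nat.

Local Notation U n := (unlabelled_locally (0 : lattice d) r n).

Lemma in_local n (g : ugraph n) :
  reflect (locally (0 : lattice d) r (ugraph_sgraph g)) (g \in U n).
Proof. by rewrite inE; exact: asboolP. Qed.

(** The graph is recovered, up to isomorphism, from what remains after the removal
    of a component of order [m] and from the code of this component. *)
Lemma card_with_component m n : (2 <= r)%N -> d = 2%N \/ (3 <= r)%N ->
  (#|[set g in U n | m \in component_orders (repr g)]| <=
     #|U (n - m)| * #|code d (code_bound d m)|)%N.
Proof.
move=> r_ge2 d_r; rewrite -(cardsT (code d _)) -cardsX.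
apply: (@leq_card_rel _ _ _ _ (fun g p => exists2 K, coded K p.2 &
  isomorphic (ugraph_sgraph g) (gsum (ugraph_sgraph p.1) K))); last first.
  move=> g g' p _ _ [K cK gK] [K' cK' gK']; apply: ugraph_isomorphic.
  apply: isomorphic_trans gK _; apply/isomorphic_sym.
  apply: isomorphic_trans gK' _; apply: gsum_isomorphic; first exact: isomorphic_refl.
  exact: coded_isomorphic cK' cK.
move=> g; rewrite inE => /andP[/in_local lg /mem_component_orders[C CE Cm]].
have [H [K [conK ordK ordH C0 iso]]] := split_component CE.
rewrite Cm in ordK ordH C0.
have lHK := locally_isomorphic (isomorphic_sym iso) lg.
have lK := locally_embedding (gsum_inr_embedding H K) lHK.
have lH := locally_embedding (gsum_inl_embedding H K) lHK.
have [h hH] := ex_ugraph ordH.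
have [c cK] := ex_coded (locally_lattice_like r_ge2 d_r lK) conK ordK C0.
exists (h, c); last first.
  exists K => //; apply: isomorphic_trans iso _.
  by apply: gsum_isomorphic; [exact: isomorphic_sym|exact: isomorphic_refl].
by rewrite !inE andbT; apply/asboolP; exact: locally_isomorphic hH lH.
Qed.

Variables (s N0 : nat).
Hypotheses (d_gt0 : (0 < d)%N) (r_s : (2 * r + 1 < s)%N) (s_N0 : (s ^ d <= N0)%N).

Definition add_circulants (l : seq nat) (H : sgraph) : sgraph :=
  foldr (fun a G => gsum G (circulant d s a.-1)) H l.

Let N0_gt0 : (0 < N0)%N.
Proof. by apply: leq_trans s_N0; rewrite expn_gt0; case: (s) r_s. Qed.

Let s_gt1 : (1 < s)%N. Proof. by apply: leq_ltn_trans r_s; rewrite addn1. Qed.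

Lemma large_circulant_local a : (N0 <= a)%N ->
  locally (0 : lattice d) r (circulant d s a.-1).
Proof.
move=> Na; apply: circulant_local r_s => //.
by rewrite prednK; [exact: leq_trans Na|exact: leq_trans Na].
Qed.

Lemma large_circulant_order a : (N0 <= a)%N -> has_order a (circulant d s a.-1).
Proof.
move=> Na; have := circulant_order d s a.-1.
by rewrite prednK //; exact: leq_trans Na.
Qed.

Lemma add_circulants_local l H : all (leq N0) l ->
  locally (0 : lattice d) r H -> locally (0 : lattice d) r (add_circulants l H).
Proof.
move=> + lH; elim: l => //= a l IHl /andP[Na /IHl lG].
by apply: locally_gsum => //; exact: large_circulant_local.
Qed.

Lemma add_circulants_order l n H : all (leq N0) l ->
  has_order n H -> has_order (n + sumn l) (add_circulants l H).
Proof.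
move=> + oH; elim: l => /= [|a l IHl]; first by rewrite addn0.
move=> /andP[Na /IHl oG]; rewrite [(a + _)%N]addnC addnA.
by apply: has_order_gsum => //; exact: large_circulant_order.
Qed.

Lemma add_circulants_cancel l H H' : all (leq N0) l ->
  isomorphic (add_circulants l H) (add_circulants l H') -> isomorphic H H'.
Proof.
elim: l => //= a l IHl /andP[Na Nl] iso; apply: IHl => //.
apply: gsum_cancel iso; first exact: circulant_connected.
by move=> f; exact: has_order_inj (large_circulant_order Na).
Qed.

Lemma add_circulants_embedding l H a : a \in l ->
  exists j : circulant d s a.-1 -> add_circulants l H, closed_embedding j.
Proof.
elim: l => //= b l IHl; rewrite inE => /orP[/eqP->|/IHl[j ej]].
  by exists inr; exact: gsum_inr_embedding.
by exists (inl \o j); apply: closed_embedding_comp ej _; exact: gsum_inl_embedding.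
Qed.

Lemma card_local_gt0 n : (N0 <= n)%N -> (0 < #|U n|)%N.
Proof.
move=> Nn; have [g gG] := ex_ugraph (large_circulant_order Nn).
apply/card_gt0P; exists g; apply/in_local.
by apply: locally_isomorphic gG _; exact: large_circulant_local.
Qed.

(** Replacing a part of order [m] by circulants of orders [a_0, ..., a_t]: the
    orders [a_1, ..., a_t] are chosen freely from [q] consecutive values, and the
    result determines the graph that remains as soon as these orders are
    known. They are component orders of the result, which leaves at most [D]
    possibilities for each. *)
Lemma card_local_growth m n t q D :
  (m <= n)%N -> (t * (N0 + q) + N0 <= m)%N ->
  (forall E : lgraph n, size (component_orders E) <= D)%N ->
  (#|U (n - m)| * q ^ t <= #|U n| * D ^ t)%N.
Proof.
move=> mn tm sD.
pose l (c : {ffun 'I_t -> 'I_q}) : seq nat :=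
  let l0 := [seq (N0 + c i)%N | i <- enum 'I_t] in (m - sumn l0)%N :: l0.
have sl0 (c : {ffun 'I_t -> 'I_q}) :
    (sumn [seq (N0 + c i)%N | i <- enum 'I_t] <= t * (N0 + q))%N.
  rewrite sumnE big_map big_enum /=.
  apply: leq_trans (_ : (\sum_(i < t) (N0 + q) <= _)%N).
    by apply: leq_sum => i _; rewrite leq_add2l ltnW.
  by rewrite sum_nat_const card_ord.
have lN c : all (leq N0) (l c).
  apply/andP; split; first by apply: leq_trans (leq_sub2l m (sl0 c)); lia.
  by apply/allP => _ /mapP[i _ ->]; exact: leq_addr.
have ls c : sumn (l c) = m.
  by rewrite /= subnK //; apply: leq_trans (sl0 c) _; lia.
have cE : (q ^ t)%N = #|[set: {ffun 'I_t -> 'I_q}]|.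
  by rewrite cardsT card_ffun !card_ord.
have DE : (D ^ t)%N = #|[set: {ffun 'I_t -> 'I_D}]|.
  by rewrite cardsT card_ffun !card_ord.
rewrite cE DE -!cardsX.
apply: (@leq_card_rel _ _ _ _ (fun (p : ugraph (n - m) * {ffun 'I_t -> 'I_q})
    (z : ugraph n * {ffun 'I_t -> 'I_D}) =>
  isomorphic (ugraph_sgraph z.1) (add_circulants (l p.2) (ugraph_sgraph p.1)) /\
  forall i, (N0 + p.2 i)%N = nth 0%N (component_orders (repr z.1)) (z.2 i))).
  case=> h c; rewrite !inE andbT => /asboolP lh.
  have oh : has_order (n - m) (ugraph_sgraph h) by exists id; exists id.
  have := add_circulants_order (lN c) oh; rewrite ls subnK // => /ex_ugraph[g gG].
  have memE (i : 'I_t) : (N0 + c i)%N \in component_orders (repr g).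
    have Ni : (N0 <= N0 + c i)%N by exact: leq_addr.
    have [j ej] : exists j : circulant d s (N0 + c i).-1 -> ugraph_sgraph g,
        closed_embedding j.
      have [|j ej] := @add_circulants_embedding (l c) (ugraph_sgraph h) (N0 + c i)%N.
        by rewrite in_cons; apply/orP; right; apply/mapP; exists i; rewrite ?mem_enum.
      have [f fP] := isomorphic_sym gG.
      by exists (f \o j); apply: closed_embedding_comp ej (iso_closed_embedding fP).
    apply/mem_component_orders; apply: component_of_embedding ej.
    - exact: circulant_connected.
    - exact: large_circulant_order.
    - exact: leq_trans Ni.
  have lenE (i : 'I_t) : (index (N0 + c i)%N (component_orders (repr g)) < D)%N.
    by apply: leq_trans (sD (repr g)); rewrite index_mem.
  exists (g, [ffun i => Ordinal (lenE i)]).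
    rewrite !inE andbT; apply/asboolP; apply: locally_isomorphic gG _.
    exact: add_circulants_local.
  split=> // i; rewrite ffunE nth_index //.
move=> [h c] [h' c'] [g b] _ _ [/= gh hc] [/= gh' hc'].
have cc : c = c' by apply/ffunP => i; apply: val_inj; apply: (@addnI N0); rewrite /= hc hc'.
rewrite -cc in gh' *; congr pair; apply: ugraph_isomorphic.
apply: add_circulants_cancel (lN c) _.
exact: isomorphic_trans (isomorphic_sym gh) gh'.
Qed.

End Counting.

(** * Asymptotics *)

(** With [c = b %/ (2 e)], one factor of [(2 ^ c) ^ 2] takes care of the constants
    and the other one of [b]. *)
Lemma leq_poly_exp K e b : (0 < K)%N -> (0 < e)%N -> (K * (2 * e) ^ 2 <= b)%N ->
  (K * b.+1 ^ e <= 2 ^ b)%N.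
Proof.
move=> K0 e0 Kb; pose E := (2 * e)%N; pose c := (b %/ E)%N.
have E0 : (0 < E)%N by rewrite muln_gt0.
have cK : (K * E <= c)%N by rewrite leq_divRL // -mulnA mulnn.
have bE : (b.+1 <= E * c.+1)%N by rewrite mulnC ltn_ceil.
have c2 : (c.+1 <= 2 ^ c)%N by exact: ltn_expl.
apply: (@leq_trans (2 ^ (c * E))); last by rewrite leq_exp2l // leq_trunc_div.
rewrite expnM /E expnM.
apply: (@leq_trans ((K * E * c.+1) ^ e)); last first.
  rewrite leq_exp2r // -mulnn; apply: (leq_mul _ c2).
  exact: leq_trans cK (leq_trans (leqnSn _) c2).
rewrite -mulnA expnMn; apply: leq_mul; last by rewrite leq_exp2r.
by rewrite -{1}[K]expn1 leq_pexp2l.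
Qed.

Lemma card_bigcup_leq (I T : finType) (P : pred I) (F : I -> {set T}) :
  (#|\bigcup_(i | P i) F i| <= \sum_(i | P i) #|F i|)%N.
Proof.
elim/big_rec2: _ => [|i A x _ IH]; first by rewrite cards0.
by apply: leq_trans (leq_card_setU _ _).1 _; rewrite leq_add2l.
Qed.

Section LargeComponents.
Variables d r : nat.
Hypotheses (d_gt0 : (0 < d)%N) (r_ge2 : (2 <= r)%N) (d_r : d = 2%N \/ (3 <= r)%N).

Local Notation U n := (unlabelled_locally (0 : lattice d) r n).

Let s := (2 * r).+2.
Let N0 := (s ^ d)%N.

(** For [b^12 <= n < (b + 1)^12], the estimate [card_local_growth] is used with
    [t = b], [q = b^8] and [D = 2 (b + 1)^6], where [8 D <= q] for large [b]. Of the
    factor [8 ^ b] that is gained, [2 ^ b] outweighs the polynomial number of codes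
    and of values of [m]. *)
Lemma card_large_component : exists B : nat, forall b n : nat,
  (B <= b)%N -> (b ^ 12 <= n < b.+1 ^ 12)%N ->
  (4 * 4 ^ b * #|[set g in U n | [exists m : 'I_n.+1,
     (b ^ 10 <= m)%N && ((m : nat) \in component_orders (repr g))]]| <= #|U n|)%N.
Proof.
have [C HC] := card_code_le d.
exists (32 + N0.+2 + 4 * (2 * (12 * C.+1)) ^ 2)%N => b n bB /andP[bn nb].
set Bad := [set _ in _ | _].
pose D := (2 * b.+1 ^ 6)%N; pose q := (b ^ 8)%N.
have b32 : (32 <= b)%N by lia.
have qD : (8 * D <= q)%N.
  rewrite /D /q.
  apply: (@leq_trans (16 * (2 * b) ^ 6)).
    rewrite mulnA leq_mul2l leq_exp2r //; lia.
  have -> : (b ^ 8 = b ^ 2 * b ^ 6)%N by rewrite -expnD.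
  rewrite expnMn mulnA.
  rewrite leq_mul2r; apply/orP; right.
  by apply: (@leq_trans (32 ^ 2)); rewrite // leq_exp2r.
have sD (E : lgraph n) : (size (component_orders E) <= D)%N.
  rewrite -(@leq_exp2r _ _ 2) //; apply: leq_trans (size_component_orders E) _.
  rewrite /D expnMn -expnM; lia.
have bad m : (b ^ 10 <= m)%N -> (m <= n)%N ->
  (8 ^ b * #|[set g in U n | m \in component_orders (repr g)]| <= #|U n| * n.+1 ^ C)%N.
  move=> bm mn.
  have m0 : (0 < m)%N by apply: leq_trans bm; rewrite expn_gt0; lia.
  have tm : (b * (N0 + q) + N0 <= m)%N.
    apply: leq_trans bm; rewrite /q.
    have -> : (b ^ 10 = b * b ^ 8 * b)%N by rewrite -expnS -expnSr.
    have : (b <= b ^ 8)%N by rewrite -{1}[b]expn1 leq_pexp2l //; lia.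
    have : (N0.+2 <= b)%N by lia.
    move: (b ^ 8)%N N0 => z y yb bz.
    have : (b * (y + 1) <= b * z)%N by rewrite leq_mul2l; apply/orP; right; lia.
    have : (b * z * 2 <= b * z * b)%N by rewrite leq_mul2l; apply/orP; right; lia.
    rewrite !mulnDr muln1; lia.
  have s1 : (2 * r + 1 < s)%N by rewrite /s; lia.
  have gr := card_local_growth d_gt0 s1 (leqnn N0) mn tm sD.
  have wc := card_with_component m n r_ge2 d_r.
  have cc := HC m n; rewrite m0 mn in cc.
  have D0 : (0 < D ^ b)%N by rewrite expn_gt0 /D muln_gt0 expn_gt0.
  rewrite -(leq_pmul2r D0) mulnAC -expnMn.
  apply: (@leq_trans (q ^ b * (#|U (n - m)| * #|code d (code_bound d m)|))).
    by apply: leq_mul => //; rewrite leq_exp2r //; lia.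
  rewrite mulnA [(q ^ b * _)%N]mulnC [leqRHS]mulnAC; apply: (leq_mul gr); exact: cc.
have cover : Bad \subset \bigcup_(m < n.+1 | (b ^ 10 <= m)%N)
    [set g in U n | (m : nat) \in component_orders (repr g)].
  apply/fintype.subsetP => g; rewrite inE => /andP[gU /existsP[m /andP[bm mg]]].
  by apply/bigcupP; exists m => //; rewrite inE gU.
have total : (8 ^ b * #|Bad| <= #|U n| * b.+1 ^ (12 * C.+1))%N.
  apply: (@leq_trans (\sum_(m < n.+1 | (b ^ 10 <= m)%N) #|U n| * n.+1 ^ C)).
    apply: (@leq_trans (8 ^ b * \sum_(m < n.+1 | (b ^ 10 <= m)%N)
       #|[set g in U n | (m : nat) \in component_orders (repr g)]|)).
      rewrite leq_mul2l; apply/orP; right.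
      exact: leq_trans (subset_leq_card cover) (card_bigcup_leq _ _).
    rewrite big_distrr /=; apply: leq_sum => m bm; apply: bad => //.
    by rewrite -ltnS.
  rewrite sum_nat_const mulnC -mulnA leq_mul2l; apply/orP; right.
  apply: (@leq_trans (n.+1 ^ C * n.+1)).
    by rewrite leq_mul2l; apply/orP; right; rewrite -[X in (_ <= X)%N]card_ord max_card.
  by rewrite -expnSr expnM leq_exp2r.
have pe : (4 * b.+1 ^ (12 * C.+1) <= 2 ^ b)%N by apply: leq_poly_exp => //; lia.
have e2 : (0 < 2 ^ b)%N by rewrite expn_gt0.
rewrite -(leq_pmul2r e2).
apply: (@leq_trans (4 * (8 ^ b * #|Bad|))).
  have -> : (8 ^ b = 4 ^ b * 2 ^ b)%N by rewrite -expnMn.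
  by rewrite -!mulnA (mulnC #|Bad|).
apply: (@leq_trans (4 * (#|U n| * b.+1 ^ (12 * C.+1)))); first by rewrite leq_mul2l total.
by rewrite mulnCA leq_mul2l pe orbT.
Qed.

End LargeComponents.

Lemma ex_root12 n : exists b : nat, (b ^ 12 <= n < b.+1 ^ 12)%N.
Proof.
have ex : exists b, (b ^ 12 <= n)%N by exists 0%N.
have ub b : (b ^ 12 <= n)%N -> (b <= n)%N.
  by apply: leq_trans; rewrite -{1}[b]expn1; case: b => // b; rewrite leq_pexp2l.
case: (ex_maxnP ex ub) => b bn bmax; exists b; rewrite bn ltnNge.
by apply/negP => /bmax; rewrite ltnn.
Qed.

Lemma powR_natX (R : realType) (b k : nat) (a : R) :
  ((b ^ k)%:R : R) `^ a = b%:R `^ (k%:R * a).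
Proof. by rewrite natrX -powR_mulrn // -powRrM. Qed.

Lemma expR_nat_le4 (R : realType) (b : nat) : expR (b%:R : R) <= 4 ^+ b.
Proof.
have e1 : expR (1 : R) <= 4.
  have h : (2^-1 : R) <= expR (- 2^-1).
    by apply: le_trans (expR_ge1Dx _); lra.
  have h2 : expR (2^-1 : R) <= 2.
    by rewrite -[2^-1]opprK expRN invf_ple ?posrE ?expR_gt0 //.
  have -> : (1 : R) = 2^-1 + 2^-1 by lra.
  rewrite expRD; apply: le_trans (ler_pM _ _ h2 h2) _; rewrite ?expR_ge0 //; lra.
by rewrite -[b%:R]mulr1 expRM_natl lerXn2r // ?nnegrE ?expR_ge0.
Qed.

Theorem theorem40 (R : realType) (d r : nat) (hd : (2 <= d)%N)
    (hr : (r0 d <= r)%N) :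
  exists N : nat, forall n : nat, (N <= n)%N ->
    1 - expR (- (n%:R `^ (1 / 13)))
    <= uniform_prob R (unlabelled_locally (0 : lattice d) r n)
         (fun g : ugraph n =>
            (max_component_order g)%:R <= n%:R `^ (5 / 6) :> R).
Proof.
have d0 : (0 < d)%N by exact: leq_trans hd.
have r2 : (2 <= r)%N by apply: leq_trans hr; rewrite /r0; case: ifP.
have dr : d = 2%N \/ (3 <= r)%N.
  by move: hr; rewrite /r0; case: eqP => [->|_]; [left|right].
have [B HB] := card_large_component d0 r2 dr.
pose N0 := ((2 * r).+2 ^ d)%N.
exists (B ^ 12 + N0 + 1)%N => n nN.
have [b bn12] := ex_root12 n; have /andP[bn nb] := bn12.
have [Bn Nn n0] : [/\ (B ^ 12 <= n)%N, (N0 <= n)%N & (0 < n)%N].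
  by move: nN; move: (B ^ 12)%N N0 => x y xy; split; lia.
have Bb : (B <= b)%N.
  by rewrite -ltnS -(@ltn_exp2r _ _ 12) //; exact: leq_ltn_trans Bn nb.
have {HB} := HB b n Bb bn12.
set U := unlabelled_locally _ _ _; set Bad := [set _ in _ | _] => bad.
have U0 : (0 < #|U|)%N.
  by apply: (@card_local_gt0 d r (2 * r).+2 N0) Nn => //; rewrite addn1.
pose P (g : ugraph n) := (max_component_order g)%:R <= n%:R `^ (5 / 6) :> R.
rewrite /uniform_prob -/P.
have badP : [set x in U | ~~ P x] \subset Bad.
  apply/fintype.subsetP => g; rewrite !inE => /andP[-> Pg] /=.
  have {}Pg : n%:R `^ (5 / 6) < (max_component_order g)%:R :> R by rewrite ltNge.
  have cn : (0 < #|components (repr g)|)%N.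
    apply/card_gt0P; exists [set y | connect (lgraph_adj (repr g)) (Ordinal n0) y].
    by apply/componentsP; eexists.
  have [Cc CE mE] := eq_bigmax_cond (fun C : {set 'I_n} => #|C|) cn.
  have Cn : (#|Cc| < n.+1)%N by rewrite ltnS -[X in (_ <= X)%N]card_ord max_card.
  apply/existsP; exists (Ordinal Cn); apply/andP; split; last first.
    by apply/mem_component_orders; exists Cc.
  move: Pg; rewrite /max_component_order mE => Pg.
  rewrite -(ler_nat R) /=; apply: le_trans (ltW Pg).
  have -> : (b ^ 10)%:R = ((b ^ 12)%:R : R) `^ (5 / 6).
    by rewrite powR_natX (_ : 12%:R * (5 / 6) = 10%:R) ?powR_mulrn ?natrX //; clear; lra.
  by apply: ge0_ler_powR; rewrite ?nnegrE ?ler_nat ?divr_ge0.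
have cU : (#|[set x in U | P x]| + #|[set x in U | ~~ P x]| = #|U|)%N.
  rewrite -(cardsID [set x | P x] U); congr (_ + _)%N; apply: eq_card => x; rewrite !inE //.
  by rewrite andbC.
have bad' : (4 * 4 ^ b * #|[set x in U | ~~ P x]| <= #|U|)%N.
  by apply: leq_trans bad; rewrite leq_mul2l subset_leq_card ?orbT.
have UR : 0 < #|U|%:R :> R by rewrite ltr0n.
have cUR : #|U|%:R = #|[set x in U | P x]|%:R + #|[set x in U | ~~ P x]|%:R :> R.
  by rewrite -natrD cU.
rewrite ler_pdivlMr // mulrBl (mul1r #|U|%:R) lerBlDr {1}cUR; apply: lerD => //.
have root_le : n%:R `^ (1 / 13) <= (b.+1)%:R :> R.
  apply: (@le_trans _ _ (((b.+1 ^ 12)%:R : R) `^ (1 / 13))).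
    by apply: ge0_ler_powR; rewrite ?nnegrE ?ler_nat ?(ltnW nb) ?divr_ge0.
  rewrite powR_natX; apply: ler1_powR; first by rewrite ler1n.
  by clear; lra.
have ex4 : expR (n%:R `^ (1 / 13)) <= (4 * 4 ^ b)%:R :> R.
  apply: (@le_trans _ _ (expR (b.+1)%:R)); first by rewrite ler_expR.
  by rewrite -expnS natrX; exact: expR_nat_le4.
rewrite expRN mulrC ler_pdivlMr ?expR_gt0 //.
apply: le_trans (_ : #|[set x in U | ~~ P x]|%:R * (4 * 4 ^ b)%:R <= _).
  by rewrite ler_wpM2l.
by rewrite -natrM ler_nat mulnC.
Qed.
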